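(* Let $n\geqslant1$, $p_1,p_2>1$, and consider the Cauchy problem $$\begin{cases}u_{tt}^N+\Delta^2u^N+\Delta\theta^N=f_1^N,&x\in\mathbb{R}^n,\ t>0,\\ \theta^N_t-\Delta\theta^N-\Delta u_t^N=f_2^N,&x\in\mathbb{R}^n,\ t>0,\\ (u^N,u_t^N,\theta^N)(0,x)=(u^N_0,u^N_1,\theta^N_0)(x),&x\in\mathbb{R}^n,\end{cases}$$ with (the case $\sigma=2$) $$f_j^N=c_{1,j}|u^N|^{p_j}+c_{2,j}\big|\,|\nabla|^{2}u^N\big|^{p_j}+c_{3,j}|u_t^N|^{p_j}+c_{4,j}|\theta^N|^{p_j},\qquad j\in\{1,2\},$$ where $c_{d,j}\geqslant0$ for any $d\in\{1,\dots,4\}$ and $j\in\{1,2\}$, and $c_{1,1}+c_{1,2}=0$, $c_{3,1}+c_{3,2}>0$, $c_{4,1}+c_{4,2}>0$. Assume that for $j\in\{1,2\}$ $$1<p_j\leqslant1+\frac2n\quad\text{if } c_{3,j}>0\text{ or }c_{4,j}>0.$$ Suppose that $u_0^N=0$ and $u_1^N+\theta_0^N\in L^1(\mathbb{R}^n)$ with $$\int_{\mathbb{R}^n}\big(u_1^N(x)+\theta_0^N(x)\big)\,\mathrm{d}x>0.$$ Then every local in time weak solution to this Cauchy problem blows up in finite time; that is, there is no global in time weak solution.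
   Context: $|\nabla|^{\sigma}g:=\mathcal{F}^{-1}(|\xi|^\sigma\widehat g\,)$, so $|\nabla|^2=-\Delta$; here $\sigma=2$. Definition (weak solution when $c_{1,1}+c_{1,2}=0$). A pair $(u^N,\theta^N)$ is a global in time weak solution of the Cauchy problem if, with $T=+\infty$, for each $j\in\{1,2\}$: $|\nabla|^{\sigma}u^N\in L^{p_j}_{\mathrm{loc}}([0,T)\times\mathbb{R}^n)$ if $c_{2,j}>0$; $u_t^N\in L^{p_j}_{\mathrm{loc}}([0,T)\times\mathbb{R}^n)$ if $c_{3,j}>0$; $\theta^N\in L^{p_j}_{\mathrm{loc}}([0,T)\times\mathbb{R}^n)$ if $c_{4,j}>0$; and the integral equalities $$\int_0^{+\infty}\!\!\int_{\mathbb{R}^n}f_1^N\Psi_1\,\mathrm{d}x\,\mathrm{d}t+\int_{\mathbb{R}^n}\Big(-u_0^N(x)\int_0^{+\infty}\Delta^2\Psi_1(\tau,x)\,\mathrm{d}\tau+u_1^N(x)\Psi_1(0,x)\Big)\mathrm{d}x$$ $$=\int_0^{+\infty}\!\!\int_{\mathbb{R}^n}u_t^N(t,x)\Big(-\partial_t\Psi_1(t,x)+\int_t^{+\infty}\Delta^2\Psi_1(\tau,x)\,\mathrm{d}\tau\Big)\mathrm{d}x\,\mathrm{d}t+\int_0^{+\infty}\!\!\int_{\mathbb{R}^n}\theta^N\Delta\Psi_1\,\mathrm{d}x\,\mathrm{d}t$$ and $$\int_0^{+\infty}\!\!\int_{\mathbb{R}^n}f_2^N\Psi_2\,\mathrm{d}x\,\mathrm{d}t+\int_{\mathbb{R}^n}\theta_0^N(x)\Psi_2(0,x)\,\mathrm{d}x$$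 $$=\int_0^{+\infty}\!\!\int_{\mathbb{R}^n}\theta^N\big(-\partial_t\Psi_2-\Delta\Psi_2\big)\mathrm{d}x\,\mathrm{d}t-\int_0^{+\infty}\!\!\int_{\mathbb{R}^n}u_t^N\Delta\Psi_2\,\mathrm{d}x\,\mathrm{d}t$$ hold for all test functions $\Psi_1,\Psi_2\in\mathcal{C}_0^\infty([0,+\infty)\times\mathbb{R}^n)$. *)

(* Defs.v *)
From HB Require Import structures.
From mathcomp Require Import all_boot all_order all_algebra.
From mathcomp Require Import all_classical all_reals all_analysis.

Set Implicit Arguments.
Unset Strict Implicit.
Unset Printing Implicit Defensive.

Import Order.TTheory GRing.Theory Num.Theory.
Import numFieldNormedType.Exports.

Local Open Scope classical_set_scope.
Local Open Scope ring_scope.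

(* Borel sigma-algebra on R^n, generated by the coordinates, as the library
   does for n.-tuple; row vectors carry the normed structure that tuples lack. *)
Definition measure_rV_display : measure_display -> measure_display.
Proof. exact. Qed.

Section measurable_rV.
Context {R : realType} (n : nat).

Let coors : 'I_n -> 'rV[R]_n -> measurableTypeR R := fun i x => x ord0 i.

Let rV_set0 : g_sigma_preimage coors set0.
Proof. exact: sigma_algebra0. Qed.

Let rV_setC A : g_sigma_preimage coors A -> g_sigma_preimage coors (~` A).
Proof. exact: sigma_algebraC. Qed.

Let rV_bigcup (F : (set 'rV[R]_n)^nat) :
  (forall i, g_sigma_preimage coors (F i)) ->
  g_sigma_preimage coors (\bigcup_i (F i)).
Proof. exact: sigma_algebra_bigcup. Qed.

HB.instance Definition _ :=
  @isMeasurable.Build (measure_rV_display default_measure_display)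
    'rV[R]_n (g_sigma_preimage coors) rV_set0 rV_setC rV_bigcup.

End measurable_rV.

Lemma measurable_coor (R : realType) n (i : 'I_n) :
  measurable_fun [set: 'rV[R]_n] (fun x => x ord0 i : measurableTypeR R).
Proof.
move=> _ Y mY; rewrite setTI; apply: sub_sigma_algebra => /=.
rewrite -bigcup_seq/=; exists i => /=; first by rewrite mem_index_enum.
by exists Y => //; rewrite setTI.
Qed.

Lemma measurable_fun_rVP d (T : measurableType d) (R : realType) n
    (f : T -> 'rV[R]_n) :
  (forall i, measurable_fun [set: T] (fun x => f x ord0 i : measurableTypeR R)) ->
  measurable_fun [set: T] f.
Proof.
move=> mf.
suff : g_sigma_preimage
    (fun i x => f x ord0 i : measurableTypeR R) `<=` measurable.
  rewrite (@g_sigma_preimage_comp _ (measurableTypeR R) n 'rV[R]_n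
    (fun i x => x ord0 i) _ f) => prefS _ A mA.
  by apply: prefS; exists A.
apply: smallest_sub; first exact: sigma_algebra_measurable.
case: n => [|m] in f mf *; first by rewrite big_ord0.
rewrite -bigcup_mkord_ord; apply: bigcup_sub => i Ii.
by move=> A [B mB <-]; exact: mf.
Qed.

Definition rV_cons (R : realType) n (z : measurableTypeR R * 'rV[R]_n) :
  'rV[R]_n.+1 := row_mx z.1%:M z.2.

Lemma measurable_rV_cons (R : realType) n :
  measurable_fun [set: measurableTypeR R * 'rV[R]_n] (@rV_cons R n).
Proof.
apply: measurable_fun_rVP => i; case: (split_ordP (i : 'I_(1 + n))) => j ->.
- rewrite [X in measurable_fun _ X](_ : _ = fst) //.
  by apply: funext => z; rewrite /rV_cons (row_mxEl z.1%:M z.2) mxE (ord1 j) eqxx mulr1n.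
- rewrite [X in measurable_fun _ X](_ : _ =
    (fun x : 'rV[R]_n => x ord0 j : measurableTypeR R) \o snd); last first.
    by apply: funext => z; rewrite /rV_cons /= (row_mxEr z.1%:M z.2).
  exact: measurableT_comp (@measurable_coor R n j) measurable_snd.
Qed.

(* Lebesgue measure on R^n as an iterated product; leb_box gives its value on
   boxes, which characterizes it. *)
Fixpoint leb (R : realType) n : set 'rV[R]_n -> \bar R :=
  match n return set 'rV[R]_n -> \bar R with
  | 0 => \d_ (0 : 'rV[R]_0)
  | m.+1 => pushforward (lebesgue_measure \x @leb R m)%E (@rV_cons R m)
  end.
Arguments leb : clear implicits.

Lemma leb_sigma_finite_measure (R : realType) n :
  exists m : {sigma_finite_measure set 'rV[R]_n -> \bar R},
    leb R n = m :> (set 'rV[R]_n -> \bar R).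
Proof.
elim: n => [|n [m mE]]; first by exists \d_ (0 : 'rV[R]_0).
unshelve epose (push := (pushforward (lebesgue_measure \x m)%E (@rV_cons R n) :
  {measure set 'rV[R]_n.+1 -> \bar R})); first exact: measurable_rV_cons.
have pushE : leb R n.+1 = push :> (set _ -> _) by rewrite /= mE.
have push_sf : sigma_finite setT push.
  have /sigma_finiteP[F [TF ndF Foo]] :=
    sigma_finiteT (@lebesgue_measure R : {sigma_finite_measure set _ -> \bar R}).
  have /sigma_finiteP[G [TG ndG Goo]] := sigma_finiteT m.
  pose g (x : 'rV[R]_n.+1) : measurableTypeR R * 'rV[R]_n :=
    (x ord0 ord0, rsubmx (x : 'rV_(1 + n))).
  have mg : measurable_fun setT g.
    apply/measurable_fun_pair; first exact: measurable_coor.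
    apply: measurable_fun_rVP => i.
    rewrite [X in measurable_fun _ X](_ : _ =
      fun x : 'rV[R]_n.+1 => x ord0 (rshift 1 i)).
      exact: measurable_coor.
    by apply: funext => x; rewrite mxE.
  have gK z : g (rV_cons z) = z.
    case: z => t x; rewrite /g /rV_cons /= row_mxKr; congr (_, _).
      rewrite (_ : ord0 = lshift n ord0 :> 'I_(1 + n)); last exact: val_inj.
      by rewrite (row_mxEl t%:M x) mxE eqxx mulr1n.
  exists (fun k => g @^-1` (F k `*` G k)).
    rewrite -preimage_bigcup -[LHS](preimage_setT g) -setXTT TF TG.
    congr (_ @^-1` _); rewrite predeqE => -[x y]; split.
      move=> [/= [i _ Fix] [k _ Gky]]; exists (maxn i k) => //; split.
      - by move: x Fix; exact/subsetPset/ndF/leq_maxl.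
      - by move: y Gky; exact/subsetPset/ndG/leq_maxr.
    by move=> [i _ []/= ? ?]; split; exists i.
  move=> k; have [mF Fk] := Foo k; have [mG Gk] := Goo k; split.
    by rewrite -[X in measurable X]setTI; apply: mg => //; exact: measurableX.
  rewrite /= /pushforward -comp_preimage (_ : g \o _ = id); last first.
    by apply: funext => z; exact: gK.
  rewrite preimage_id product_measure1E// lte_mul_pinfty//.
  by rewrite ge0_fin_numE.
pose H := Measure_isSigmaFinite.Build _ _ _ push push_sf.
pose sf : {sigma_finite_measure set 'rV[R]_n.+1 -> \bar R} :=
  HB.pack_for {sigma_finite_measure set 'rV[R]_n.+1 -> \bar R}
    (push : set 'rV[R]_n.+1 -> \bar R) push H.
by exists sf.
Qed.

Section leb_measure.
Context (R : realType) (n : nat).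

Let leb0 : leb R n set0 = 0%E.
Proof. by have [m ->] := leb_sigma_finite_measure R n; exact: measure0. Qed.

Let leb_ge0 A : (0 <= leb R n A)%E.
Proof. by have [m ->] := leb_sigma_finite_measure R n; exact: measure_ge0. Qed.

Let leb_semi_sigma_additive : semi_sigma_additive (leb R n).
Proof.
have [m ->] := leb_sigma_finite_measure R n.
exact: measure_semi_sigma_additive.
Qed.

HB.instance Definition _ :=
  isMeasure.Build _ _ _ (leb R n) leb0 leb_ge0 leb_semi_sigma_additive.

Let leb_sigma_finite : sigma_finite setT (leb R n).
Proof.
by have [m ->] := leb_sigma_finite_measure R n; exact: sigma_finiteT.
Qed.

HB.instance Definition _ :=
  Measure_isSigmaFinite.Build _ _ _ (leb R n) leb_sigma_finite.

End leb_measure.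

Lemma measurable_box (R : realType) n (A : 'I_n -> set (measurableTypeR R)) :
  (forall i, measurable (A i)) ->
  measurable [set x : 'rV[R]_n | forall i, A i (x ord0 i)].
Proof.
move=> mA.
rewrite (_ : [set x | _] = \big[setI/setT]_(i < n)
    ((fun x : 'rV[R]_n => x ord0 i : measurableTypeR R) @^-1` A i)).
  apply: bigsetI_measurable => i _.
  by rewrite -[X in measurable X]setTI; exact: measurable_coor.
rewrite -bigcap_seq; apply/seteqP; split => x /= Ax i; first by move=> _; exact: Ax.
by apply: Ax; rewrite /= mem_index_enum.
Qed.

Lemma leb_box (R : realType) n (A : 'I_n -> set (measurableTypeR R)) :
  (forall i, measurable (A i)) ->
  leb R n [set x | forall i, A i (x ord0 i)] =
  (\prod_(i < n) lebesgue_measure (A i))%E.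
Proof.
elim: n A => [|n IH] A mA.
  by rewrite big_ord0 /= diracE mem_set//= => -[].
have ord0E : ord0 = lshift n ord0 :> 'I_(1 + n) by exact: val_inj.
have liftE j : lift ord0 j = rshift 1 j :> 'I_(1 + n) by exact: val_inj.
rewrite big_ord_recl -IH//= -product_measure1E//; last first.
  by apply: (@measurable_box R n (fun i => A (lift ord0 i))) => i; exact: mA.
rewrite /pushforward; congr product_measure1.
apply/seteqP; split=> -[t x] /=; rewrite /rV_cons /=.
  move=> Atx; split=> [|i].
    by have := Atx ord0; rewrite ord0E (row_mxEl t%:M x) mxE eqxx mulr1n.
  by have := Atx (lift ord0 i); rewrite liftE (row_mxEr t%:M x).
move=> [At Ax] i; case: (unliftP ord0 i) => [j|] ->.
  by rewrite [in X in _ X]liftE (row_mxEr t%:M x); exact: Ax.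
by rewrite [in X in _ X]ord0E (row_mxEl t%:M x) mxE eqxx mulr1n.
Qed.

Section thermoelastic_plate.
Context {R : realType} {n : nat}.
Local Notation X := 'rV[R]_n.
Local Notation TX := (R * 'rV[R]_n)%type.

Definition leb_tx : set (measurableTypeR R * X) -> \bar R :=
  (lebesgue_measure \x leb R n)%E.

Definition closed_half_space : set TX := [set z | 0 <= z.1].
Definition open_half_space : set TX := [set z | 0 < z.1].

(* L^p_loc(D), with D of the form I `*` setT: compacts are compacts of R^{1+n}
   contained in D, so for the closed half-space they may touch {t = 0}. *)
Definition Lp_loc_tx (D : set TX) (p : R) (f : TX -> R) : Prop :=
  measurable_fun (D : set (measurableTypeR R * X)) f /\
  forall K : set TX, compact K -> K `<=` D ->
    (\int[leb_tx]_(z in K) (`|f z| `^ p)%:E < +oo)%E.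

Definition L1_loc_x (f : X -> R) : Prop :=
  measurable_fun setT f /\
  forall K : set X, compact K -> (\int[leb R n]_(x in K) `|f x|%:E < +oo)%E.

Definition smooth (f : TX -> R) : Prop :=
  forall vs : seq TX,
    let g := foldr (fun v h => 'D_v h) f vs in
    continuous g /\ forall v z, derivable g z v.

(* C_c^oo functions on R^{1+n} with support in D.  An element of
   C_0^oo([0,+oo) x R^n) is the restriction to the closed half-space of such a
   function with D = setT; only its values for t >= 0 are ever used below. *)
Definition test_function (D : set TX) (f : TX -> R) : Prop :=
  [/\ smooth f, compact (closure [set z | f z != 0])
    & closure [set z | f z != 0] `<=` D].

Definition dt (f : TX -> R) : TX -> R := 'D_((1, 0) : TX) f.
Definition dx (i : 'I_n) (f : TX -> R) : TX -> R :=
  'D_((0, delta_mx ord0 i) : TX) f.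
Definition laplacian (f : TX -> R) : TX -> R :=
  fun z => \sum_(i < n) dx i (dx i f) z.
Definition bilaplacian (f : TX -> R) : TX -> R := laplacian (laplacian f).

(* v = u_t in the sense of distributions on (0,+oo) x R^n *)
Definition is_weak_dt (u v : TX -> R) : Prop :=
  [/\ Lp_loc_tx open_half_space 1 u, Lp_loc_tx open_half_space 1 v
    & forall phi, test_function open_half_space phi ->
      \int[leb_tx]_(z in open_half_space) (v z * phi z) =
      - \int[leb_tx]_(z in open_half_space) (u z * dt phi z)].

(* w = |nabla|^2 u = - Delta u in the sense of distributions *)
Definition is_weak_nabla2 (u w : TX -> R) : Prop :=
  [/\ Lp_loc_tx open_half_space 1 u, Lp_loc_tx open_half_space 1 w
    & forall phi, test_function open_half_space phi ->
      \int[leb_tx]_(z in open_half_space) (w z * phi z) =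
      \int[leb_tx]_(z in open_half_space) (u z * - laplacian phi z)].

(* Right-hand side f_j; w stands for |nabla|^2 u and v for u_t. *)
Definition nonlinearity (c1 c2 c3 c4 p : 'I_2 -> R) (u w v theta : TX -> R)
    (j : 'I_2) : TX -> R :=
  fun z => c1 j * `|u z| `^ p j + c2 j * `|w z| `^ p j
         + c3 j * `|v z| `^ p j + c4 j * `|theta z| `^ p j.

(* Global weak solutions when c_{1,1} + c_{1,2} = 0.  The index j in {1,2} is
   (0 : 'I_2), (1 : 'I_2).  When c2 vanishes, |nabla|^2 u need not be a function
   and w is a dummy with coefficient 0.  Local integrability of the data is what
   gives a meaning to the integrals against test functions. *)
Definition global_weak_solution (c1 c2 c3 c4 p : 'I_2 -> R)
    (u0 u1 theta0 : X -> R) (u theta : TX -> R) : Prop :=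
  [/\ L1_loc_x u0, L1_loc_x u1 & L1_loc_x theta0] /\
  exists v w : TX -> R,
  [/\ is_weak_dt u v,
      forall j, 0 < c2 j ->
        is_weak_nabla2 u w /\ Lp_loc_tx closed_half_space (p j) w,
      forall j, 0 < c3 j -> Lp_loc_tx closed_half_space (p j) v,
      forall j, 0 < c4 j -> Lp_loc_tx closed_half_space (p j) theta
    & let f := nonlinearity c1 c2 c3 c4 p u w v theta in
      forall Psi1 Psi2 : TX -> R,
      test_function setT Psi1 -> test_function setT Psi2 ->
      \int[leb_tx]_(z in closed_half_space) (f 0 z * Psi1 z)
      + \int[leb R n]_x
          (- u0 x * \int[lebesgue_measure]_(tau in `[0, +oo[)
                      bilaplacian Psi1 (tau, x)
           + u1 x * Psi1 (0, x))
      = \int[leb_tx]_(z in closed_half_space)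
          (v z * (- dt Psi1 z
                  + \int[lebesgue_measure]_(tau in `[z.1, +oo[)
                      bilaplacian Psi1 (tau, z.2)))
        + \int[leb_tx]_(z in closed_half_space) (theta z * laplacian Psi1 z)
      /\
      \int[leb_tx]_(z in closed_half_space) (f 1 z * Psi2 z)
      + \int[leb R n]_x (theta0 x * Psi2 (0, x))
      = \int[leb_tx]_(z in closed_half_space)
          (theta z * (- dt Psi2 z - laplacian Psi2 z))
        - \int[leb_tx]_(z in closed_half_space) (v z * laplacian Psi2 z)].

End thermoelastic_plate.

(* Main.v *)
Require Import Defs.
From HB Require Import structures.
From mathcomp Require Import all_boot all_order all_algebra.
From mathcomp Require Import all_classical all_reals all_analysis.
From mathcomp Require Import measurable_realfun ring lra.

Set Implicit Arguments.
Unset Strict Implicit.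
Unset Printing Implicit Defensive.

Import Order.TTheory GRing.Theory Num.Theory.
Import numFieldNormedType.Exports.

Local Open Scope classical_set_scope.
Local Open Scope ring_scope.

(** The proof is the test function method.  Use one test function Psi in both
integral equalities and add them.  The terms theta Delta Psi cancel, and with
v = u_t one is left with
  iint (f_1 + f_2) Psi + int (u_1 + theta_0) Psi(0, x)
  = iint v (- dt Psi - Delta Psi + int_t^oo Delta^2 Psi) - iint theta dt Psi.
Take Psi to be a fixed profile read at (lam^2 t, lam x).  Every differential
expression on the right then has size lam^2 and lives, for t >= 0, in a box of
measure 2^n lam^-(n+2), whereas the left-hand side controls
c |v|^p + d |theta|^q for some c, d > 0 and critical or subcritical p and q.

Absorption.  Up to the exponent 1 + 2/n, the integrand lam^2 W is controlled by
its p-th power according to whether W exceeds eps lam^n or not: small values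
contribute at most eps lam^(n+2), whose integral over the box is a constant,
and large values are at most eps^(1-p) W^p ([critical_large],
[critical_young], [lower_order_le]).  Hence the weighted integrals of |v|^p and
|theta|^q stay bounded as lam tends to 0, and by Fatou's lemma |v|^p and
|theta|^q are integrable on the whole half-space.

Limit.  Once |v|^p is integrable, the large values of lam^2 |v| are dominated
by a fixed integrable function and tend to 0 pointwise, while the small ones
cost only a multiple of eps, which is arbitrary.  So the right-hand side tends
to 0 ([lower_order_vanishes]); the data term tends to a positive multiple of
the integral of u_1 + theta_0 ([cvg_data]).  This is the contradiction of
[energy_contradiction].

Choice of Psi.  Absorption requires every differential expression in Psi to be
bounded by the powers E^(1/p), E^(1/q) of a weight E <= 2 Psi.  The functions
P(1/s) exp(-1/s) have this property and are stable under differentiation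
([flat], [flat_bound]).  The space factor of Psi is such a function of
s = 1 - lam^2 |x|^2, on which the Laplacian acts as an operator on P alone
([laplacian_profile]); the time factor is minus the derivative of such a
function, which makes int_t^oo Psi explicit ([tail_integral_profile]). *)

(** * Functions flat at the edge of their support *)

Section flat.
Context {R : realType}.
Implicit Types (P Q : {poly R}) (s a w : R).

(** Writing the functions as polynomials in 1/s times exp(-1/s) turns
differentiation into the algebraic operation [flat_deriv] on P; the function
for P = 1 is the standard smooth function flat at 0. *)
Definition flat P s : R := if 0 < s then P.[s^-1] * expR (- s^-1) else 0.

Definition flat_deriv P : {poly R} := 'X^2 * (P - P^`()).

Lemma flat_le0 P s : s <= 0 -> flat P s = 0.
Proof. by move=> s0; rewrite /flat ltNge s0. Qed.

Lemma flat_gt0E P s : 0 < s -> flat P s = P.[s^-1] * expR (- s^-1).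
Proof. by rewrite /flat => ->. Qed.

Lemma flatD P Q s : flat (P + Q) s = flat P s + flat Q s.
Proof. by rewrite /flat; case: ifP => _; rewrite ?addr0// hornerD mulrDl. Qed.

Lemma flatN P s : flat (- P) s = - flat P s.
Proof. by rewrite /flat; case: ifP => _; rewrite ?oppr0// hornerN mulNr. Qed.

Lemma flatZ a P s : flat (a *: P) s = a * flat P s.
Proof. by rewrite /flat; case: ifP => _; rewrite ?mulr0// hornerZ mulrA. Qed.

(** By induction on P: one more factor w costs half of the exponential room, since
a/2 * w <= exp(a/2 * w). *)
Lemma poly_le_expR P a : 0 < a ->
  exists2 C : R, 0 <= C & forall w, 0 <= w -> `|P.[w]| <= C * expR (a * w).
Proof.
elim/poly_ind: P a => [|P c IH] a a0.
  by exists 0 => // w _; rewrite horner0 normr0 mul0r.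
have a2 : 0 < a / 2 by rewrite divr_gt0.
have [C C0 PC] := IH _ a2.
have C1 : 0 <= C * (a / 2)^-1 by rewrite mulr_ge0// invr_ge0 ltW.
exists (C * (a / 2)^-1 + `|c|) => [|w w0]; first by rewrite addr_ge0.
rewrite hornerD hornerM hornerX hornerC (le_trans (ler_normD _ _))// mulrDl.
apply: lerD; last first.
  rewrite ler_peMr// -expR0 ler_expR mulr_ge0//; exact: ltW.
rewrite normrM (ger0_norm w0).
have -> : expR (a * w) = expR (a / 2 * w) * expR (a / 2 * w).
  by rewrite -expRD; congr expR; lra.
rewrite mulrACA; apply: ler_pM => //; first exact: PC.
rewrite ler_pdivlMl// (le_trans _ (expR_ge1Dx _))//; lra.
Qed.

(** All functions of the family are comparable up to an arbitrarily small loss in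
the exponent, since exp(-(1-a)/s) beats any polynomial in 1/s.  This replaces
the usual device of raising a cutoff to a large power. *)
Lemma flat_bound P a : a < 1 ->
  exists2 C : R, 0 <= C & forall s, `|flat P s| <= C * flat 1 s `^ a.
Proof.
move=> a1; have a1' : 0 < 1 - a by rewrite subr_gt0.
have [C C0 PC] := poly_le_expR P a1'.
exists C => // s; rewrite /flat; case: ifPn => s0; last first.
  by rewrite normr0 mulr_ge0// powR_ge0.
rewrite hornerC mul1r -expRM normrM (ger0_norm (expR_ge0 _)).
rewrite -(ler_pM2r (expR_gt0 (s^-1))) -!mulrA -!expRD addNr expR0 mulr1.
rewrite (_ : - s^-1 * a + s^-1 = (1 - a) * s^-1); last by lra.
by apply: PC; rewrite invr_ge0 ltW.
Qed.

(** Gives differentiability at 0, the only point where the definition by cases is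
not locally a smooth formula. *)
Lemma flat_quad P : exists2 C : R, 0 <= C & forall s, `|flat P s| <= C * s ^+ 2.
Proof.
have [C C0 PC] := poly_le_expR (P * 'X^2) (@ltr01 R).
exists C => // s; rewrite /flat; case: ifPn => s0; last first.
  by rewrite normr0 mulr_ge0// sqr_ge0.
have si : 0 <= s^-1 by rewrite invr_ge0 ltW.
have := PC _ si; rewrite hornerM hornerXn normrM mul1r.
rewrite (ger0_norm (exprn_ge0 _ si)) normrM (ger0_norm (expR_ge0 _)).
rewrite exprVn ler_pdivrMr ?exprn_gt0// => H.
rewrite -(ler_pM2r (expR_gt0 (s^-1))) -!mulrA -expRD addNr expR0 mulr1.
by rewrite (le_trans H)// expr2 -[leLHS]mulrA (mulrC (expR _)) -[in leLHS](mulrA s).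
Qed.

Lemma is_derive_flat P s : is_derive s 1 (flat P) (flat (flat_deriv P) s).
Proof.
have [s0|s0|->] := ltgtP s 0.
- apply: (@near_eq_is_derive _ _ _ (cst 0)).
    near=> y; rewrite flat_le0//.
    by apply: ltW; near: y; exact: lt_nbhsl.
  by rewrite flat_le0 ?ltW//; exact: is_derive_cst.
- apply: (@near_eq_is_derive _ _ _ ((horner P \o GRing.inv) \* (expR \o -%R \o GRing.inv))).
    near=> y; rewrite flat_gt0E//=.
    by near: y; exact: lt_nbhsr.
  have s_neq0 : s != 0 by rewrite gt_eqF.
  have dV : is_derive s 1 GRing.inv (- s ^- 2).
    have := @is_deriveV _ id s 1 1 s_neq0 (is_derive_id _ _).
    by rewrite /GRing.scale/= mulr1.
  have dN : is_derive s 1 (-%R \o GRing.inv) (s ^- 2).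
    by have := is_deriveN dV; rewrite opprK.
  have d1 := @is_derive1_comp _ (horner P) GRing.inv s _ _ (is_derive_poly _ _) dV.
  have d2 := @is_derive1_comp _ expR (-%R \o GRing.inv) s _ _ (is_derive_expR _) dN.
  apply: (is_derive_eq (is_deriveM d1 d2)).
  rewrite flat_gt0E// /flat_deriv hornerM hornerXn hornerD hornerN.
  by rewrite /= /GRing.scale/= exprVn; ring.
- rewrite flat_le0//.
  have [C C0 PC] := flat_quad P.
  suff H : (fun h : R => h^-1 *: ((flat P \o shift 0) (h *: 1) - flat P 0)) @ 0^' --> (0 : R).
    by apply: DeriveDef; [apply/cvg_ex; exists 0|exact/cvg_lim].
  apply/cvgr0Pnorm_lt => /= e e0.
  have C1 : 0 < C + 1 by lra.
  have eC : 0 < e / (C + 1) by rewrite divr_gt0.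
  near=> h.
  rewrite (flat_le0 P (lexx 0)) subr0 /= addr0 /GRing.scale/= mulr1.
  have h0 : h != 0 by near: h; exact: nbhs_dnbhs_neq.
  rewrite normrM normfV ltr_pdivrMl ?normr_gt0//.
  apply: le_lt_trans (PC h) _.
  rewrite -real_normK ?num_real// expr2 mulrCA ltr_pM2l ?normr_gt0//.
  apply: (@le_lt_trans _ _ ((C + 1) * `|h|)); first by rewrite ler_wpM2r//; lra.
  rewrite mulrC -ltr_pdivlMr//.
  by near: h; exact: dnbhs0_lt.
Unshelve. all: by end_near. Qed.

Lemma differentiable_flat P s : differentiable (flat P) s.
Proof. by apply/derivable1_diffP; case: (is_derive_flat P s). Qed.

Lemma continuous_flat P : continuous (flat P).
Proof. by move=> s; exact/differentiable_continuous/differentiable_flat. Qed.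

End flat.

(** * Smooth compactly supported profiles *)

Section profiles.
Context {R : realType} {n : nat}.
Implicit Types (P Q a : {poly R}) (s t lam y : R) (x : 'rV[R]_n).
Local Notation TX := (R * 'rV[R]_n)%type.

(** Reduces directional derivatives to the calculus of functions of one real
variable. *)
Lemma is_derive_lineP (V : normedModType R) (f : V -> R) (z v : V) (d : R) :
  is_derive z v f d <-> is_derive (0 : R) 1 (fun h : R => f (h *: v + z)) d.
Proof.
have E : 'D_v f z = 'D_1 (fun h : R => f (h *: v + z)) 0.
  rewrite /derive; set g1 := fun h => h^-1 *: _; set g2 := fun h => h^-1 *: _.
  suff -> : g1 = g2 by [].
  by apply/funext => h; rewrite /g1 /g2 /= addr0 scale0r add0r [_%:A]mulr1.
split=> -[D dE]; split.
- by move/derivable1P : D.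
- by rewrite -E.
- by apply/derivable1P.
- by rewrite E.
Qed.

Lemma is_derive_flat_comp (V : normedModType R) P (g : V -> R) (z v : V)
    (dg : R) : is_derive z v g dg ->
  is_derive z v (flat P \o g) (flat (flat_deriv P) (g z) * dg).
Proof.
move/is_derive_lineP => dgl; apply/is_derive_lineP.
apply: (@is_derive1_comp _ (flat P)); rewrite scale0r add0r.
exact: is_derive_flat.
Qed.

(** Smoothness quantifies over all iterated directional derivatives.  A class of
differentiable functions that is stable under every directional derivative
settles all of them at once, and this one contains the profiles. *)
Inductive elementary : (TX -> R) -> Prop :=
| elementary_cst c : elementary (cst c)
| elementary_time : elementary (fun z => z.1)
| elementary_coord i : elementary (fun z => z.2 ord0 i)
| elementary_add f g : elementary f -> elementary g ->
    elementary (fun z => f z + g z)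
| elementary_mul f g : elementary f -> elementary g ->
    elementary (fun z => f z * g z)
| elementary_flat P g : elementary g -> elementary (flat P \o g).

Lemma differentiable_elementary f z : elementary f -> differentiable f z.
Proof.
elim=> [c||i|{}f g _ df _ dg|{}f g _ df _ dg|P g _ dg].
- exact: differentiable_cst.
- by apply: linear_differentiable => z'; exact: cvg_fst.
- apply: (@differentiable_comp _ _ _ _ snd (fun x : 'rV[R]_n => x ord0 i)).
    by apply: linear_differentiable => z'; exact: cvg_snd.
  exact: differentiable_coord.
- exact: differentiableD.
- exact: differentiableM.
- by apply: differentiable_comp => //; exact: differentiable_flat.
Qed.

Lemma is_derive_time (z v : TX) : is_derive z v (fun z : TX => z.1) v.1.
Proof.
apply/is_derive_lineP => /=.
rewrite [X in is_derive _ _ X](_ : _ = (fun h : R => h * v.1 + z.1))//.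
apply: (is_derive_eq (is_deriveD (is_deriveM (is_derive_id _ _)
  (is_derive_cst _ _ _)) (is_derive_cst _ _ _))).
by rewrite /GRing.scale/= mulr0 mulr1 add0r addr0.
Qed.

Lemma is_derive_coord i (z v : TX) :
  is_derive z v (fun z : TX => z.2 ord0 i) (v.2 ord0 i).
Proof.
apply/is_derive_lineP => /=.
rewrite [X in is_derive _ _ X](_ : _ =
  (fun h : R => h * v.2 ord0 i + z.2 ord0 i)); last first.
  by apply/funext => h; rewrite !mxE.
apply: (is_derive_eq (is_deriveD (is_deriveM (is_derive_id _ _)
  (is_derive_cst _ _ _)) (is_derive_cst _ _ _))).
by rewrite /GRing.scale/= mulr0 mulr1 add0r addr0.
Qed.

Lemma elementary_derive f v : elementary f -> elementary ('D_v f).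
Proof.
elim=> [c||i|{}f g ef df eg dg|{}f g ef df eg dg|P g eg dg].
- rewrite (_ : 'D_v _ = cst 0); first exact: elementary_cst.
  by apply/funext => z; rewrite derive_cst.
- rewrite (_ : 'D_v _ = cst v.1); first exact: elementary_cst.
  by apply/funext => z; case: (is_derive_time z v).
- rewrite (_ : 'D_v _ = cst (v.2 ord0 i)); first exact: elementary_cst.
  by apply/funext => z; case: (is_derive_coord i z v).
- rewrite (_ : 'D_v _ = fun z => 'D_v f z + 'D_v g z).
    exact: elementary_add.
  by apply/funext => z; rewrite deriveD//;
    exact/diff_derivable/differentiable_elementary.
- rewrite (_ : 'D_v _ = fun z => f z * 'D_v g z + g z * 'D_v f z).
    by apply: elementary_add; exact: elementary_mul.
  by apply/funext => z; rewrite deriveM//;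
    exact/diff_derivable/differentiable_elementary.
- rewrite (_ : 'D_v _ = fun z => (flat (flat_deriv P) \o g) z * 'D_v g z).
    by apply: elementary_mul => //; exact: elementary_flat.
  apply/funext => z.
  have /derivableP dgz : derivable g z v.
    exact/diff_derivable/differentiable_elementary.
  by case: (is_derive_flat_comp P dgz).
Qed.

Lemma smooth_elementary f : elementary f -> smooth f.
Proof.
move=> ef vs; have eg : elementary (foldr (fun v h => 'D_v h) f vs).
  by elim: vs => //= v vs IH; exact: elementary_derive.
split=> [z|v z]; first exact/differentiable_continuous/differentiable_elementary.
exact/diff_derivable/differentiable_elementary.
Qed.

Lemma elementary_horner a f : elementary f -> elementary (fun z => a.[f z]).
Proof.
move=> ef; elim/poly_ind: a => [|p c IH].
  rewrite (_ : (fun _ => _) = cst 0); first exact: elementary_cst.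
  by apply/funext => z; rewrite horner0.
rewrite (_ : (fun _ => _) = fun z => p.[f z] * f z + cst c z).
  by apply: elementary_add; [exact: elementary_mul|exact: elementary_cst].
by apply/funext => z; rewrite hornerD hornerM hornerX hornerC.
Qed.

Definition sqnorm x : R := \sum_(i < n) x ord0 i ^+ 2.

(** The shift by 1 sends t = 0 to y = 1/2, inside the interval y^2 < 1 on which the
time factor lives; there the factor y of the cutoff is bounded away from 0. *)
Definition rescaled_time lam t : R := (lam ^+ 2 * t + 1) / 2.
Definition time_profile a P y : R := a.[y] * flat P (1 - y ^+ 2).

(** The factor a makes the family stable under time differentiation, which brings
out the derivative - 2 y of 1 - y^2. *)
Definition profile a P Q lam (z : TX) : R :=
  time_profile a P (rescaled_time lam z.1) * flat Q (1 - lam ^+ 2 * sqnorm z.2).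

Lemma elementary_profile a P Q lam : elementary (profile a P Q lam).
Proof.
have es : elementary (fun z => rescaled_time lam z.1).
  apply: elementary_mul; last exact: (elementary_cst 2^-1).
  apply: elementary_add; last exact: (elementary_cst 1).
  by apply: elementary_mul; [exact: (elementary_cst (_ ^+ 2))|exact: elementary_time].
apply: elementary_mul; first apply: elementary_mul.
- exact: elementary_horner.
- apply: (@elementary_flat P (fun z => 1 - rescaled_time lam z.1 ^+ 2)).
  rewrite (_ : (fun _ => _) = fun z => (1 - 'X^2).[rescaled_time lam z.1]).
    exact: elementary_horner.
  by apply/funext => z; rewrite hornerD hornerC hornerN hornerXn.
- apply: (@elementary_flat Q (fun z => 1 - lam ^+ 2 * sqnorm z.2)).
  rewrite (_ : (fun _ => _) = fun z => cst 1 z + cst (- lam ^+ 2) z * sqnorm z.2).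
    apply: elementary_add; first exact: elementary_cst.
    apply: elementary_mul; first exact: elementary_cst.
    rewrite /sqnorm; elim: (index_enum _) => [|i s IH].
      rewrite (_ : (fun _ => _) = cst 0); first exact: elementary_cst.
      by apply/funext => z; rewrite big_nil.
    rewrite (_ : (fun _ => _) =
      fun z : TX => z.2 ord0 i * z.2 ord0 i + \sum_(j <- s) z.2 ord0 j ^+ 2).
      by apply: elementary_add => //; apply: elementary_mul; exact: elementary_coord.
    by apply/funext => z; rewrite big_cons expr2.
  by apply/funext => z /=; rewrite mulNr.
Qed.

Lemma sqnorm_coord x i : x ord0 i ^+ 2 <= sqnorm x.
Proof. by rewrite /sqnorm (bigD1 i)//= lerDl sumr_ge0// => j _; exact: sqr_ge0. Qed.

Lemma profile_eq0_time a P Q lam z : 1 <= rescaled_time lam z.1 ^+ 2 -> profile a P Q lam z = 0.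
Proof. by move=> y1; rewrite /profile /time_profile flat_le0 ?mulr0 ?mul0r// subr_le0. Qed.

Lemma profile_eq0_space a P Q lam z :
  1 <= lam ^+ 2 * sqnorm z.2 -> profile a P Q lam z = 0.
Proof. by move=> y1; rewrite /profile (@flat_le0 _ Q) ?mulr0 ?mul0r// subr_le0. Qed.

Definition space_box r : set 'rV[R]_n :=
  [set x | forall i, `[(- r : R), r]%classic (x ord0 i)].

Lemma compact_tx_box (t0 t1 r : R) :
  compact (`[t0, t1] `*` space_box r : set TX).
Proof.
apply: compact_setX; first exact: segment_compact.
apply: (@rV_compact R n (fun=> `[(- r : R), r]%classic)) => i.
exact: segment_compact.
Qed.

Lemma profile_eq0_coord a P Q lam z : 0 < lam ->
  (~ space_box lam^-1 z.2) -> profile a P Q lam z = 0.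
Proof.
move=> lam0 zb; apply: contrapT => T0; apply: zb => i; apply: contrapT => zi.
apply: T0; apply: profile_eq0_space.
have {}zi : lam^-1 < `|z.2 ord0 i|.
  rewrite ltNge; apply/negP => H; apply: zi.
  by rewrite /= in_itv/= -ler_norml.
apply: (@le_trans _ _ (lam ^+ 2 * z.2 ord0 i ^+ 2)); last first.
  by rewrite ler_wpM2l ?sqr_ge0// sqnorm_coord.
rewrite -exprMn -[_ ^+ 2]real_normK ?num_real// expr_ge1// normrM (gtr0_norm lam0).
by rewrite -ler_pdivrMl// mulr1 ltW.
Qed.

(** The support lies in y^2 <= 1 and lam^2 |x|^2 <= 1, hence in a compact box that
reaches t = - 3 / lam^2. *)
Lemma test_function_profile a P Q lam : 0 < lam ->
  test_function setT (profile a P Q lam).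
Proof.
move=> lam0; split=> //; first exact/smooth_elementary/elementary_profile.
have cK := @compact_tx_box (- 3 / lam ^+ 2) (1 / lam ^+ 2) lam^-1.
apply: (subclosed_compact _ cK); first exact: closed_closure.
have : closed (`[(- 3 / lam ^+ 2), (1 / lam ^+ 2)] `*` space_box lam^-1 : set TX).
  by apply: compact_closed => //; exact: norm_hausdorff.
move/closure_id => ->; apply: closureS => z /= /eqP zT; split; last first.
  by apply: contrapT => zb; apply: zT; exact: profile_eq0_coord.
apply: contrapT => zt; apply: zT; apply: profile_eq0_time.
have l2 : 0 < lam ^+ 2 by rewrite exprn_gt0.
move: zt; rewrite /= in_itv/= /rescaled_time ler_pdivrMr// ler_pdivlMr// => /negP.
rewrite negb_and -!ltNge (mulrC z.1).
set w := lam ^+ 2 * z.1 => zt.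
case/orP: zt => ?; nra.
Qed.

End profiles.

(** * Time derivative and Laplacians of the profiles *)

Section profile_derivatives.
Context {R : realType} {n : nat}.
Implicit Types (P Q a : {poly R}) (s t lam y : R) (x : 'rV[R]_n).
Local Notation TX := (R * 'rV[R]_n)%type.
Local Notation profile := (@profile R n).

(** The second term keeps the shape of a profile because d(1 - y^2)/dy = - 2 y is
again a polynomial. *)
Lemma is_derive_time_profile a P y : is_derive y 1 (time_profile a P)
  (time_profile a^`() P y + time_profile (- 2%:R *: ('X * a)) (flat_deriv P) y).
Proof.
have dq : is_derive y 1 (fun y : R => 1 - y ^+ 2) (- (2 * y)).
  rewrite [X in is_derive _ _ X](_ : _ = fun y : R => cst 1 y - y * y).
    apply: (is_derive_eq (is_deriveB (is_derive_cst _ _ _)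
      (is_deriveM (is_derive_id _ _) (is_derive_id _ _)))).
    by rewrite sub0r /GRing.scale/= mulr1 mulr_natl mulr2n.
  by apply/funext => ?; rewrite expr2.
apply: (is_derive_eq (is_deriveM (is_derive_poly a y)
  (is_derive_flat_comp P dq))).
by rewrite /time_profile /GRing.scale/= hornerZ hornerM hornerX; ring.
Qed.

Definition profile_dt a P Q lam (z : TX) : R :=
  profile a^`() P Q lam z + profile (- 2%:R *: ('X * a)) (flat_deriv P) Q lam z.

Lemma is_derive_rescaled_time (f : R -> R) (df lam t : R) :
  is_derive (rescaled_time lam t) 1 f df ->
  is_derive t 1 (fun t => f (rescaled_time lam t)) (lam ^+ 2 / 2 * df).
Proof.
move=> fd.
have sd : is_derive t 1 (rescaled_time lam) (lam ^+ 2 / 2).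
  rewrite (_ : rescaled_time lam = fun t : R => cst (lam ^+ 2 / 2) t * t + cst (2^-1) t); last first.
    by apply/funext => r; rewrite /rescaled_time/=; ring.
  apply: (is_derive_eq (is_deriveD (is_deriveM (is_derive_cst _ _ _)
    (is_derive_id _ _)) (is_derive_cst _ _ _))).
  by rewrite /GRing.scale/= mulr0 mulr1 !addr0.
by apply: (is_derive_eq (@is_derive1_comp _ f _ _ _ _ fd sd)); rewrite mulrC.
Qed.

Lemma dt_profile a P Q lam :
  dt (profile a P Q lam) = fun z => lam ^+ 2 / 2 * profile_dt a P Q lam z.
Proof.
apply/funext => z.
suff : is_derive z ((1, 0) : TX) (profile a P Q lam)
  (lam ^+ 2 / 2 * profile_dt a P Q lam z) by case.
apply/is_derive_lineP; rewrite /profile /=.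
set B := flat Q (1 - lam ^+ 2 * sqnorm z.2).
rewrite [X in is_derive _ _ X](_ : _ = fun h : R =>
  (time_profile a P (rescaled_time lam (h + z.1))) * cst B h); last first.
  by apply/funext => h /=; rewrite [_%:A]mulr1 scaler0 add0r.
have sd : is_derive (0 : R) 1 (fun h : R => time_profile a P (rescaled_time lam (h + z.1)))
    (lam ^+ 2 / 2 * (time_profile a^`() P (rescaled_time lam z.1) +
      time_profile (- 2%:R *: ('X * a)) (flat_deriv P) (rescaled_time lam z.1))).
  have : is_derive (0 + z.1) 1 (fun t : R => time_profile a P (rescaled_time lam t))
      (lam ^+ 2 / 2 * (time_profile a^`() P (rescaled_time lam z.1) +
      time_profile (- 2%:R *: ('X * a)) (flat_deriv P) (rescaled_time lam z.1))).
    by rewrite add0r; exact/is_derive_rescaled_time/is_derive_time_profile.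
  move=> H; apply: (is_derive_eq (@is_derive1_comp _ _ (fun h : R => h + z.1) _ _ _ H
    (is_deriveD (is_derive_id _ _) (is_derive_cst _ _ _)))).
  by rewrite addr0 mulr1.
apply: (is_derive_eq (is_deriveM sd (is_derive_cst _ _ _))).
by rewrite /profile_dt /profile -/B /GRing.scale/=; ring.
Qed.

Definition space_dir (i : 'I_n) : TX := (0, delta_mx ord0 i).

Lemma is_derive_sqnorm i (z : TX) :
  is_derive z (space_dir i) (fun z : TX => sqnorm z.2) (2 * z.2 ord0 i).
Proof.
rewrite [X in is_derive _ _ X](_ : _ =
  \sum_(j < n) (fun z : TX => z.2 ord0 j) ^+ 2); last first.
  by apply/funext => w; rewrite fct_sumE.
apply: is_derive_eq.
  by apply: is_derive_sum => j; apply: is_deriveX; exact: is_derive_coord.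
rewrite /= (bigD1 i)//= big1 => [|j ji].
  by rewrite mxE !eqxx expr1 addr0 /GRing.scale/= mulr1 mulr_natl.
by rewrite mxE (negbTE ji) andbF scaler0.
Qed.

Lemma is_derive_dx_profile i a P Q lam (z : TX) :
  is_derive z (space_dir i) (profile a P Q lam)
    (- 2 * lam ^+ 2 * z.2 ord0 i * profile a P (flat_deriv Q) lam z).
Proof.
have d1 : is_derive z (space_dir i) (fun z : TX => time_profile a P (rescaled_time lam z.1)) 0.
  apply/is_derive_lineP.
  rewrite [X in is_derive _ _ X](_ : _ = cst (time_profile a P (rescaled_time lam z.1))).
    exact: is_derive_cst.
  by apply/funext => h /=; rewrite scaler0 add0r.
have d2 : is_derive z (space_dir i) (fun z : TX => 1 - lam ^+ 2 * sqnorm z.2)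
    (- (lam ^+ 2 * (2 * z.2 ord0 i))).
  apply: (is_derive_eq (is_deriveB (is_derive_cst _ _ _)
    (is_deriveM (is_derive_cst (lam ^+ 2) _ _) (is_derive_sqnorm i z)))).
  by rewrite /GRing.scale/= mulr0 addr0 sub0r.
apply: (is_derive_eq (is_deriveM d1 (is_derive_flat_comp Q d2))).
by rewrite /profile /GRing.scale/=; ring.
Qed.

Lemma dx_profile i a P Q lam : dx i (profile a P Q lam) =
  fun z => - 2 * lam ^+ 2 * z.2 ord0 i * profile a P (flat_deriv Q) lam z.
Proof. by apply/funext => z; case: (is_derive_dx_profile i a P Q lam z). Qed.

(** For F(s) with s = 1 - lam^2 |x|^2 one has Delta F(s) =
lam^2 (4 (1 - s) F'' - 2 n F').  The product s F'' stays in the family, as F''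
corresponds to a polynomial divisible by the variable. *)
Definition radial_laplacian Q : {poly R} :=
  4%:R *: (flat_deriv (flat_deriv Q)
           - 'X * (flat_deriv Q - (flat_deriv Q)^`()))
  - (2 * n)%:R *: flat_deriv Q.

(** Multiplying by s lowers the degree in 1/s. *)
Lemma flat_mulX Q s : s * flat ('X * Q) s = flat Q s.
Proof.
have [s0|s0] := leP s 0; first by rewrite !flat_le0// mulr0.
by rewrite !flat_gt0E// hornerM hornerX !mulrA divff ?mul1r// gt_eqF.
Qed.

Lemma flat_radial_laplacian Q s : flat (radial_laplacian Q) s =
  4 * (1 - s) * flat (flat_deriv (flat_deriv Q)) s
  - 2 * n%:R * flat (flat_deriv Q) s.
Proof.
rewrite /radial_laplacian flatD flatN !flatZ flatD flatN.
rewrite natrM -[in LHS](flat_mulX ('X * _)).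
rewrite (_ : 'X * ('X * _) = flat_deriv (flat_deriv Q)); last first.
  by rewrite /(flat_deriv (flat_deriv _)) mulrA -expr2.
ring.
Qed.

Lemma laplacian_profile a P Q lam : laplacian (profile a P Q lam) =
  fun z => lam ^+ 2 * profile a P (radial_laplacian Q) lam z.
Proof.
apply/funext => z; rewrite /laplacian.
have dd i : dx i (dx i (profile a P Q lam)) z =
    - 2 * lam ^+ 2 * profile a P (flat_deriv Q) lam z +
    (4 * lam ^+ 4 * profile a P (flat_deriv (flat_deriv Q)) lam z) * z.2 ord0 i ^+ 2.
  rewrite dx_profile.
  suff : is_derive z (space_dir i) (fun z : TX =>
      - 2 * lam ^+ 2 * z.2 ord0 i * profile a P (flat_deriv Q) lam z)
    (- 2 * lam ^+ 2 * profile a P (flat_deriv Q) lam z +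
    (4 * lam ^+ 4 * profile a P (flat_deriv (flat_deriv Q)) lam z) * z.2 ord0 i ^+ 2).
    by case.
  apply: (is_derive_eq (is_deriveM (is_deriveM (is_derive_cst (- 2 * lam ^+ 2) _ _)
    (is_derive_coord i _ _)) (is_derive_dx_profile i a P (flat_deriv Q) lam z))).
  rewrite /GRing.scale/= mxE !eqxx mulr1 mulrfctE /=; ring.
rewrite (eq_bigr _ (fun i _ => dd i)) big_split/= -[X in _ + X]mulr_sumr -/(sqnorm z.2).
rewrite sumr_const card_ord /profile flat_radial_laplacian.
rewrite -[X in X + _]mulr_natl; ring.
Qed.

Lemma flat_derivZ s Q : flat_deriv (s *: Q) = s *: flat_deriv Q.
Proof. by rewrite /flat_deriv derivZ -scalerBr scalerAr. Qed.

Lemma profileZ a P Q lam s : (fun z => s * profile a P Q lam z) = profile a P (s *: Q) lam.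
Proof. by apply/funext => z; rewrite /profile flatZ mulrCA. Qed.

Lemma radial_laplacianZ s Q : radial_laplacian (s *: Q) = s *: radial_laplacian Q.
Proof.
rewrite /radial_laplacian !flat_derivZ derivZ -scalerBr -scalerAr -scalerBr.
by rewrite !(scalerA _ s) !(mulrC _ s) -!(scalerA s) -scalerBr.
Qed.

Lemma bilaplacian_profile a P Q lam : bilaplacian (profile a P Q lam) =
  fun z => lam ^+ 4 * profile a P (radial_laplacian (radial_laplacian Q)) lam z.
Proof.
rewrite /bilaplacian laplacian_profile profileZ laplacian_profile radial_laplacianZ.
by rewrite -profileZ; apply/funext => z; rewrite mulrA -exprD.
Qed.

End profile_derivatives.

(** * The cutoff and its weight *)

Section profile_estimates.
Context {R : realType} {n : nat}.
Implicit Types (P Q a : {poly R}) (s t lam y : R) (x : 'rV[R]_n).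
Local Notation TX := (R * 'rV[R]_n)%type.
Local Notation MTX := (measurableTypeR R * 'rV[R]_n)%type.
Local Notation profile := (@profile R n).

Lemma continuous_time_profile a P : continuous (@time_profile R a P).
Proof.
move=> y; apply/differentiable_continuous/derivable1_diffP.
by case: (is_derive_time_profile a P y).
Qed.

Lemma continuous_rescaled_time lam : continuous (rescaled_time lam).
Proof.
move=> u; rewrite /rescaled_time; apply: cvgM; last exact: cvg_cst.
apply: cvgD; last exact: cvg_cst.
by apply: cvgM; [exact: cvg_cst|exact: cvg_id].
Qed.

Lemma time_profile_ge0 lam t : 0 <= t -> 0 <= time_profile 'X 'X^2 (rescaled_time lam t).
Proof.
move=> t0; rewrite /time_profile hornerX mulr_ge0//.
  by rewrite /rescaled_time divr_ge0// addr_ge0// mulr_ge0 ?sqr_ge0.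
rewrite /flat; case: ifP => // s0; rewrite mulr_ge0 ?expR_ge0//.
by rewrite hornerXn exprn_ge0// invr_ge0 ltW.
Qed.

(** The integrand is, up to the factor - lam^2, the derivative of
flat 1 (1 - y^2), which vanishes for large times. *)
Lemma tail_integral_time_profile lam t : 0 < lam -> 0 <= t ->
  (\int[lebesgue_measure]_(tau in `[t, +oo[)
    (time_profile 'X 'X^2 (rescaled_time lam tau))%:E =
  (lam ^- 2 * time_profile 1 1 (rescaled_time lam t))%:E)%E.
Proof.
move=> lam0 t0; have l2 : 0 < lam ^+ 2 by rewrite exprn_gt0.
pose F t : R := (- lam ^- 2) * time_profile 1 1 (rescaled_time lam t).
have dF (u : R) : is_derive u 1 F (time_profile 'X 'X^2 (rescaled_time lam u)).
  apply: (is_derive_eq (is_deriveM (is_derive_cst (- lam ^- 2) _ _)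
    (is_derive_rescaled_time (is_derive_time_profile 1 1 (rescaled_time lam u))))).
  rewrite /time_profile derivC horner0 mul0r add0r /flat_deriv derivC subr0 mulr1.
  rewrite mulr1 hornerZ /GRing.scale/= mulr0 addr0 hornerX.
  by field; rewrite gt_eqF.
have cF (u : R) : F v @[v --> u] --> F u.
  by apply/differentiable_continuous/derivable1_diffP; case: (dF u).
rewrite (@ge0_continuous_FTC2y R (fun u => time_profile 'X 'X^2 (rescaled_time lam u)) F t 0).
- by rewrite -EFinB sub0r /F mulNr opprK.
- by move=> u tu; rewrite time_profile_ge0// (le_trans t0).
- apply: continuous_subspaceT => u.
  by apply: continuous_comp; [exact: continuous_rescaled_time|exact: continuous_time_profile].
- apply: cvg_near_cst; near=> u.
  rewrite /F /time_profile flat_le0 ?mulr0// subr_le0.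
  rewrite expr_ge1//.
    rewrite /rescaled_time ler_pdivlMr// mul1r -lerBlDr.
    rewrite -ler_pdivrMl// mulrC; near: u; apply: nbhs_pinfty_ge; exact: num_real.
  rewrite /rescaled_time divr_ge0// addr_ge0// mulr_ge0 ?sqr_ge0//.
- by move=> u _; case: (dF u).
- by apply: cvg_at_right_filter; exact: cF.
- by move=> u _; rewrite derive1E; case: (dF u).
Unshelve. all: by end_near. Qed.

Lemma tail_integral_profile Q lam t x : 0 < lam -> 0 <= t ->
  \int[lebesgue_measure]_(tau in `[t, +oo[) profile 'X 'X^2 Q lam (tau, x) =
  lam ^- 2 * profile 1 1 Q lam (t, x).
Proof.
move=> lam0 t0.
have I := tail_integral_time_profile lam0 t0.
rewrite /profile /= RintegralZr//; last first.
  apply/integrableP; split.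
    apply/measurable_EFinP; apply: measurable_funTS.
    apply: continuous_measurable_fun => u; apply: continuous_comp.
      exact: continuous_rescaled_time.
    exact: continuous_time_profile.
  rewrite [X in (X < _)%E](_ : _ =
    (lam ^- 2 * time_profile 1 1 (rescaled_time lam t))%:E) ?ltry// -I.
  apply: eq_integral => u; rewrite inE/= in_itv/= andbT => tu.
  by rewrite ger0_norm// time_profile_ge0// (le_trans t0).
by rewrite /Rintegral I [fine _]/= -mulrA.
Qed.

Lemma flat1_ge0 s : 0 <= flat 1 s :> R.
Proof. by rewrite /flat; case: ifP => //; rewrite hornerC mul1r expR_ge0. Qed.

Lemma flat1_le1 s : flat 1 s <= 1 :> R.
Proof.
rewrite /flat; case: ifP => // s0; rewrite hornerC mul1r expR_le1.
by rewrite oppr_le0 invr_ge0 ltW.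
Qed.

(** The common yardstick: it bounds the cutoff from below and, up to a small loss
in the exponent, the differential expressions in the cutoff from above. *)
Definition weight lam : TX -> R := profile 1 1 1 lam.

Lemma weightE lam z : weight lam z =
  flat 1 (1 - rescaled_time lam z.1 ^+ 2) * flat 1 (1 - lam ^+ 2 * sqnorm z.2).
Proof. by rewrite /weight /profile /time_profile hornerC mul1r. Qed.

Lemma weight_ge0 lam z : 0 <= weight lam z.
Proof. by rewrite weightE mulr_ge0// flat1_ge0. Qed.

Lemma weight_le1 lam z : weight lam z <= 1.
Proof. by rewrite weightE mulr_ile1 ?flat1_ge0 ?flat1_le1. Qed.

Lemma rescaled_time_ge lam t : 0 <= t -> 2^-1 <= rescaled_time lam t.
Proof.
by move=> t0; rewrite /rescaled_time ler_peMl// lerDr mulr_ge0// sqr_ge0.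
Qed.

(** The constant does not depend on lam: a profile depends on lam only through
y and lam x, and y ranges over [1/2, 1] on the part t >= 0 of the support. *)
Lemma profile_bound a P Q b : b < 1 -> exists2 C : R, 0 <= C &
  forall lam (z : TX), 0 <= z.1 -> `|profile a P Q lam z| <= C * weight lam z `^ b.
Proof.
move=> b1; have [C1 C10 bP] := flat_bound P b1; have [C2 C20 bQ] := flat_bound Q b1.
have [C3 C30 ba] := poly_le_expR a (@ltr01 R).
exists (C3 * expR 1 * (C1 * C2)) => [|lam z z0].
  by rewrite !mulr_ge0// expR_ge0.
have y0 := rescaled_time_ge lam z0.
have yge0 : 0 <= rescaled_time lam z.1 by apply: le_trans y0; rewrite invr_ge0.
have [y1|y1] := leP 1 (rescaled_time lam z.1).
  rewrite profile_eq0_time ?expr_ge1// normr0.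
  by rewrite mulr_ge0 ?powR_ge0// !mulr_ge0// expR_ge0.
rewrite weightE powRM ?flat1_ge0// /profile /time_profile !normrM -[leLHS]mulrA.
have H1 : `|a.[rescaled_time lam z.1]| <= C3 * expR 1.
  rewrite (le_trans (ba _ yge0))// ler_wpM2l// ler_expR mul1r; exact: ltW.
rewrite -[leRHS]mulrA [X in _ <= _ * X]mulrACA.
by do 2!apply: ler_pM => //.
Qed.

Definition cutoff lam : TX -> R := profile 'X 'X^2 1 lam.

(** For t >= 0 the polynomial factor is y >= 1/2, and 1/s^2 >= 1 since s <= 1. *)
Lemma weight_le_cutoff lam z : 0 <= z.1 -> weight lam z <= 2 * cutoff lam z.
Proof.
move=> z0; have y0 := rescaled_time_ge lam z0.
rewrite weightE /cutoff /profile /time_profile mulrA ler_wpM2r ?flat1_ge0//.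
rewrite hornerX mulrA.
have F0 : 0 <= flat 1 (1 - rescaled_time lam z.1 ^+ 2) := flat1_ge0 _.
have F1 : flat 1 (1 - rescaled_time lam z.1 ^+ 2) <= flat 'X^2 (1 - rescaled_time lam z.1 ^+ 2).
  rewrite /flat; case: ifP => // s0; rewrite ler_wpM2r ?expR_ge0//.
  rewrite hornerC hornerXn exprVn invf_ge1 ?exprn_gt0//.
  by rewrite expr_le1 ?(ltW s0)// lerBlDr lerDl sqr_ge0.
rewrite (le_trans F1)// ler_peMl ?(le_trans F0)//.
by rewrite -ler_pdivrMl// mulr1.
Qed.

Lemma cutoff_ge0 lam z : 0 <= z.1 -> 0 <= cutoff lam z.
Proof.
move=> z0; have := le_trans (weight_ge0 lam z) (weight_le_cutoff lam z0).
by rewrite pmulr_rge0.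
Qed.

(** As lam tends to 0 the profile spreads out: y tends to 1/2 and lam x to 0. *)
Lemma cvg_profile a P Q (lam_ : nat -> R) z : lam_ @ \oo --> 0 ->
  (fun N => profile a P Q (lam_ N) z) @ \oo -->
  time_profile a P 2^-1 * flat Q 1.
Proof.
move=> lam0.
have lam20 : (fun N => lam_ N ^+ 2) @ \oo --> 0.
  rewrite (_ : (fun _ => _) = lam_ \* lam_); last by apply/funext.
  by rewrite -(mulr0 (0 : R)); exact: cvgM.
apply: cvgM.
  apply: continuous_cvg; first exact: continuous_time_profile.
  rewrite (_ : 2^-1 = (0 * z.1 + 1) / 2); last by rewrite mul0r add0r mul1r.
  apply: cvgM; last exact: cvg_cst.
  by apply: cvgD; [apply: cvgM => //; exact: cvg_cst|exact: cvg_cst].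
apply: continuous_cvg; first exact: continuous_flat.
rewrite [X in _ --> X](_ : _ = 1 - 0 * sqnorm z.2); last by rewrite mul0r subr0.
apply: cvgB; first exact: cvg_cst.
exact: (cvgM lam20 (cvg_cst (sqnorm z.2))).
Qed.

Lemma measurable_flat P : measurable_fun [set: R] (@flat R P).
Proof. by apply: continuous_measurable_fun; exact: continuous_flat. Qed.

Lemma measurable_elementary (f : TX -> R) :
  elementary f -> measurable_fun [set: MTX] (f : MTX -> R).
Proof.
elim=> [c||i|{}f g _ mf _ mg|{}f g _ mf _ mg|P g _ mg].
- exact: measurable_cst.
- exact: measurable_fst.
- apply: (@measurableT_comp _ _ _ _ _ _ (fun x : 'rV[R]_n => x ord0 i)).
    exact: measurable_coor.
  exact: measurable_snd.
- exact: measurable_funD.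
- exact: measurable_funM.
- exact: (measurableT_comp (measurable_flat P) mg).
Qed.

Lemma measurable_profile a P Q lam : measurable_fun [set: MTX] (profile a P Q lam : MTX -> R).
Proof. by apply: measurable_elementary; exact: elementary_profile. Qed.

(** Contains the part t >= 0 of the support of every profile; the power of lam in its
measure is what the critical exponent has to match. *)
Definition support_box lam : set MTX :=
  `[0, lam ^- 2]%classic `*` space_box lam^-1.

Lemma measurable_space_box (r : R) : measurable (space_box r : set 'rV[R]_n).
Proof. by apply: (@measurable_box R n (fun=> `[- r, r]%classic)). Qed.

Lemma measurable_support_box lam : measurable (support_box lam).
Proof. by apply: measurableX => //; exact: measurable_space_box. Qed.

Lemma leb_space_box (r : R) : 0 < r ->
  leb R n (space_box r) = ((2 * r) ^+ n)%:E.
Proof.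
move=> r0.
transitivity (\prod_(i < n) lebesgue_measure (`[(- r)%R, r]%classic : set R))%E.
  exact: (@leb_box R n (fun=> `[- r, r]%classic)).
rewrite (eq_bigr (fun=> (2 * r)%:E)) => [|i _].
  by rewrite prodEFin prodr_const card_ord.
by rewrite lebesgue_measure_itv/= lte_fin gtrN// -EFinD opprK -mulr2n mulr_natl.
Qed.

Lemma leb_support_box lam : 0 < lam ->
  leb_tx (support_box lam) = (2 ^+ n * lam ^- (n + 2))%:E.
Proof.
move=> lam0; have li : 0 < lam^-1 by rewrite invr_gt0.
rewrite /leb_tx product_measure1E//; last exact: measurable_space_box.
rewrite [X in (_ * X)%E](leb_space_box li).
transitivity (lebesgue_measure (`[0%R, lam ^- 2]%classic : set R) *
  ((2 / lam) ^+ n)%:E)%E => //.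
rewrite lebesgue_measure_itv/= lte_fin.
rewrite invr_gt0 exprn_gt0// -EFinD -EFinM subr0; congr EFin.
by rewrite exprMn exprVn mulrCA exprD [in RHS]invfM [in LHS](mulrC (lam ^- 2)).
Qed.

Lemma profile_eq0 a P Q lam z : 0 < lam -> 0 <= z.1 ->
  ~ support_box lam z -> profile a P Q lam z = 0.
Proof.
move=> lam0 z0 zb; apply: contrapT => T0; apply: zb; split; last first.
  by apply: contrapT => zx; apply: T0; exact: profile_eq0_coord.
rewrite /= in_itv/= z0/=; rewrite leNgt; apply/negP => zt; apply: T0.
apply: profile_eq0_time; rewrite expr_ge1//; last first.
  by apply: le_trans (rescaled_time_ge lam z0); rewrite invr_ge0.
rewrite /rescaled_time ler_pdivlMr// mul1r -lerBlDr.
rewrite -ler_pdivrMl ?exprn_gt0// (_ : 2 - 1 = 1) ?mulr1; last by ring.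
exact: ltW.
Qed.

End profile_estimates.

(** * Absorption at the critical exponent *)

Lemma measurable_norm_powR d (T : measurableType d) {R : realType} (D : set T)
    (f : T -> R) (p : R) :
  measurable_fun D f -> measurable_fun D (fun z => `|f z| `^ p).
Proof.
move=> mf; apply: (@measurableT_comp _ _ _ _ _ _ (fun x : R => x `^ p) _
  (fun z => `|f z|)); first exact: measurable_powR.
exact: measurableT_comp.
Qed.

Section integrable_EFin.
Context d (T : measurableType d) {R : realType}.
Context (mu : {measure set T -> \bar R}) (D : set T) (mD : measurable D).
Implicit Types f g : T -> R.

Lemma integrable_EFinD f g :
  mu.-integrable D (EFin \o f) -> mu.-integrable D (EFin \o g) ->
  mu.-integrable D (EFin \o (fun z => f z + g z)).
Proof. by move=> /integrableD h /h => /(_ mD). Qed.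

Lemma integrable_EFinZl (k : R) f :
  mu.-integrable D (EFin \o f) ->
  mu.-integrable D (EFin \o (fun z => k * f z)).
Proof. exact: integrableZl. Qed.

End integrable_EFin.

Section critical_estimate.
Context {R : realType} {n : nat} (n_gt0 : (0 < n)%N).
Implicit Types (lam eps p : R).
Local Notation TX := (R * 'rV[R]_n)%type.
Local Notation MTX := (measurableTypeR R * 'rV[R]_n)%type.

(* Lets the integration theorems see the measure structure behind the name. *)
HB.instance Definition _ := Measure.copy (@leb_tx R n)
  (lebesgue_measure \x leb R n)%E.

Local Notation mu := (@leb_tx R n).
Local Notation H := (@closed_half_space R n : set MTX).

Lemma measurable_half_space : measurable H.
Proof.
rewrite (_ : H = `[0, +oo[%classic `*` setT); first exact: measurableX.
by apply/seteqP; split=> z /=; rewrite in_itv/= andbT; [|case].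
Qed.
Hint Resolve measurable_half_space : core.

(** Since p - 1 <= 2/n and lam <= 1, the threshold satisfies
(lam^n)^(p-1) >= lam^2: this is where the exponent 1 + 2/n enters. *)
Lemma critical_large p lam eps (W : R) : 1 < p <= 1 + 2 / n%:R ->
  0 < lam <= 1 -> 0 < eps -> eps * lam ^+ n <= W ->
  lam ^+ 2 * W <= eps `^ (1 - p) * W `^ p.
Proof.
move=> /andP[p1 pn] /andP[lam0 lam1] eps0 WL.
have nR : 0 < n%:R :> R by rewrite ltr0n.
have W0 : 0 < W by rewrite (lt_le_trans _ WL)// mulr_gt0// exprn_gt0.
have p0 : 0 < p by rewrite (lt_trans _ p1).
have pm0 : 0 <= p - 1 by rewrite subr_ge0 ltW.
rewrite -(mulr_powRB1 (ltW W0) p0) mulrCA [leLHS]mulrC ler_pM2l//.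
rewrite -(opprB p 1) powRN mulrC ler_pdivlMr ?powR_gt0//.
apply: (@le_trans _ _ ((eps * lam ^+ n) `^ (p - 1))); last first.
  by rewrite ge0_ler_powR// nnegrE ltW// mulr_gt0// exprn_gt0.
rewrite powRM ?exprn_ge0 ?(ltW eps0) ?(ltW lam0)// mulrC ler_wpM2l ?powR_ge0//.
rewrite -!powR_mulrn ?(ltW lam0)// -powRrM ger_powR ?lam0//.
rewrite mulrC -ler_pdivlMr//; lra.
Qed.

Lemma critical_young p lam eps (W : R) : 1 < p <= 1 + 2 / n%:R ->
  0 < lam <= 1 -> 0 < eps -> 0 <= W ->
  lam ^+ 2 * W <= eps * lam ^+ (n + 2) + eps `^ (1 - p) * W `^ p.
Proof.
move=> pn lam01 eps0 W0; have /andP[lam0 _] := lam01.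
have [WL|WL] := leP (eps * lam ^+ n) W.
  rewrite (le_trans (critical_large pn lam01 eps0 WL))// lerDr.
  by rewrite mulr_ge0 ?exprn_ge0 ?ltW.
rewrite (@le_trans _ _ (eps * lam ^+ (n + 2)))//; last first.
  by rewrite lerDl mulr_ge0 ?powR_ge0.
by rewrite addnC exprD mulrCA ler_wpM2l ?sqr_ge0// ltW.
Qed.

Lemma support_box_sub lam : support_box lam `<=` H.
Proof. by move=> z [/=]; rewrite in_itv/= => /andP[]. Qed.

Lemma weight_powR_le1 (b : R) lam (z : TX) : 0 <= b -> weight lam z `^ b <= 1 :> R.
Proof.
move=> b0; apply: (@le_trans _ _ (1 `^ b)); last by rewrite powR1.
by rewrite ge0_ler_powR ?nnegrE ?weight_ge0 ?weight_le1.
Qed.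

Lemma measurable_weight_powR (b : R) lam :
  measurable_fun [set: MTX] (fun z : MTX => weight lam z `^ b : R).
Proof.
apply: (@measurableT_comp _ _ _ _ _ _ (fun x : R => x `^ b) _
  (fun z : MTX => weight lam z)); first exact: measurable_powR.
exact: measurable_profile.
Qed.

Lemma integral_support_box lam (c : R) : 0 < lam ->
  mu.-integrable H (EFin \o (fun z => c * \1_(@support_box R n lam) z)) /\
  \int[mu]_(z in H) (c * \1_(@support_box R n lam) z) =
  c * (2 ^+ n * lam ^- (n + 2)).
Proof.
move=> lam0; have mK := @measurable_support_box R n lam.
have i1 : mu.-integrable H (EFin \o \1_(support_box lam)).
  apply/integrableP; split; first exact/measurable_EFinP.
  rewrite (eq_integral (fun z => (\1_(@support_box R n lam) z)%:E)); last first.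
    by move=> z _ /=; rewrite ger0_norm.
  rewrite integral_indic// (setIidl (@support_box_sub lam)).
  by rewrite [X in (X < _)%E](leb_support_box lam0) ltry.
split.
  exact: integrable_EFinZl.
rewrite RintegralZl// /Rintegral integral_indic//.
by rewrite (setIidl (@support_box_sub lam)) [X in fine X](leb_support_box lam0).
Qed.

Section Lp_loc_function.
Context (p : R) (f : TX -> R) (p_gt1 : 1 < p)
  (Lpf : Lp_loc_tx (@closed_half_space R n) p f).

Let p_gt0 : 0 < p. Proof. exact: lt_trans p_gt1. Qed.

Let mf : measurable_fun H (f : MTX -> R). Proof. by case: Lpf. Qed.

Let mfp : measurable_fun H (fun z => `|f z| `^ p : R).
Proof. exact: measurable_norm_powR. Qed.

(** On the box, which is compact and of finite measure, both products are dominated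
by a multiple of 1 + |f|^p. *)
Lemma integrable_cutoff_mul lam (g : TX -> R) (C : R) : 0 < lam ->
  measurable_fun [set: MTX] (g : MTX -> R) ->
  (forall z, H z -> `|g z| <= C) ->
  (forall z, H z -> ~ support_box lam z -> g z = 0) ->
  mu.-integrable H (EFin \o (fun z => f z * g z)) /\
  mu.-integrable H (EFin \o (fun z => `|f z| `^ p * g z)).
Proof.
move=> lam0 mg gC g0; set K := @support_box R n lam.
have mK : measurable K := measurable_support_box lam.
have KH : K `<=` H := @support_box_sub lam.
have KHE : H `&` K = K by apply/setIidr.
have C0 z : K z -> 0 <= C by move=> Kz; rewrite (le_trans _ (gC z (KH _ Kz))).
have muK : (mu K < +oo)%E by rewrite leb_support_box// ltry.
have ip : mu.-integrable K (EFin \o (fun z => `|f z| `^ p)).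
  apply/integrableP; split.
    by apply/measurable_EFinP; apply: measurable_funS mfp.
  have [_ /(_ K)] := Lpf; rewrite /K /support_box.
  move=> /(_ (@compact_tx_box _ _ _ _ _) KH).
  by under eq_integral do rewrite -[X in (X%:E)%E]ger0_norm ?powR_ge0//.
have reduce (h : MTX -> R) : measurable_fun H h ->
    (forall z, H z -> ~ K z -> h z = 0) ->
    (forall z, K z -> `|h z| <= C * (1 + `|f z| `^ p)) ->
    mu.-integrable H (EFin \o h).
  move=> mh h0 hC.
  have : mu.-integrable K (EFin \o h).
    apply: (@le_integrable _ _ _ _ _ mK _
      (EFin \o (fun z => C * (1 + `|f z| `^ p)))).
    - by apply/measurable_EFinP; apply: measurable_funS mh.
    - move=> z Kz /=; rewrite lee_fin (le_trans (hC z Kz))//.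
      exact: ler_norm.
    - rewrite (_ : _ \o _ = fun z => (C%:E * ((cst 1 z)%:E + (`|f z| `^ p)%:E))%E)//.
      apply: integrableZl => //; apply: integrableD => //.
      apply/integrableP; split; first exact/measurable_EFinP.
      under eq_integral do rewrite /= normr1.
      by rewrite integral_cst// mul1e.
  rewrite -[X in integrable _ X]KHE.
  move=> /(integrable_restrict mu mK measurable_half_space _).1.
  apply: eq_integrable => // z; rewrite inE => Hz; rewrite /patch.
  case: ifPn => //; rewrite notin_setE => /(h0 _ Hz) /= ->.
  by [].
have mgH : measurable_fun H (g : MTX -> R) by exact: measurable_funTS.
have f1p z : `|f z| <= 1 + `|f z| `^ p.
  have [f1|f1] := leP 1 `|f z|.
    by rewrite (le_trans (le1r_powR f1 (ltW p_gt1)))// lerDr.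
  by rewrite (le_trans (ltW f1))// lerDl powR_ge0.
split; apply: reduce.
- exact: measurable_funM.
- by move=> z Hz Kz; rewrite g0 ?mulr0.
- move=> z Kz; rewrite normrM mulrC ler_pM//.
  exact/gC/KH.
- exact: measurable_funM.
- by move=> z Hz Kz; rewrite g0 ?mulr0.
- move=> z Kz; rewrite normrM mulrC ler_pM//; first exact/gC/KH.
  by rewrite ger0_norm ?powR_ge0// lerDr.
Qed.

Lemma integrable_norm_weight lam : 0 < lam ->
  mu.-integrable H (EFin \o (fun z => `|f z| * weight lam z `^ p^-1)).
Proof.
move=> lam0; have pV0 : 0 <= p^-1 by rewrite invr_ge0 ltW.
have [] := @integrable_cutoff_mul lam (fun z => weight lam z `^ p^-1) 1 lam0.
- exact: measurable_weight_powR.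
- by move=> z _; rewrite ger0_norm ?powR_ge0// weight_powR_le1.
- move=> z Hz zK; rewrite /weight (profile_eq0 _ _ _ lam0 Hz zK) powR0//.
  by rewrite invr_eq0 gt_eqF.
move=> /integrable_norm + _; apply: eq_integrable => // z _ /=.
by rewrite normrM (ger0_norm (powR_ge0 _ _)).
Qed.

Lemma integrable_powR_weight lam : 0 < lam ->
  mu.-integrable H (EFin \o (fun z => `|f z| `^ p * weight lam z)).
Proof.
move=> lam0.
have [] := @integrable_cutoff_mul lam (weight lam) 1 lam0.
- exact: measurable_profile.
- by move=> z _; rewrite ger0_norm ?weight_ge0// weight_le1.
- by move=> z Hz zK; exact: profile_eq0.
by [].
Qed.

Lemma powR_norm_weight lam (z : TX) :
  (`|f z| * weight lam z `^ p^-1) `^ p = `|f z| `^ p * weight lam z.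
Proof.
by rewrite powRM ?powR_ge0// -powRrM mulVf ?gt_eqF// powRr1 ?weight_ge0.
Qed.

(** [critical_young] for W = |f| E^(1/p), whose p-th power is |f|^p E, integrated
over the box. *)
Lemma lower_order_le lam eps : p <= 1 + 2 / n%:R -> 0 < lam <= 1 -> 0 < eps ->
  lam ^+ 2 * \int[mu]_(z in H) (`|f z| * weight lam z `^ p^-1) <=
  eps * 2 ^+ n +
  eps `^ (1 - p) * \int[mu]_(z in H) (`|f z| `^ p * weight lam z).
Proof.
move=> pn lam01 eps0; have /andP[lam0 _] := lam01.
have iB := integrable_norm_weight lam0; have iA := integrable_powR_weight lam0.
have [iK IK] := integral_support_box (eps * lam ^+ (n + 2)) lam0.
rewrite [X in X + _](_ : _ = \int[mu]_(z in H)
    (eps * lam ^+ (n + 2) * \1_(@support_box R n lam) z)); last first.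
  by rewrite IK mulrACA divff ?mulr1// gt_eqF// exprn_gt0.
rewrite -!RintegralZl// -RintegralD//; last exact: integrable_EFinZl.
apply: le_Rintegral => //.
- exact: integrable_EFinZl.
- by apply: integrable_EFinD => //; exact: integrable_EFinZl.
move=> z Hz; rewrite -powR_norm_weight.
have W0 : 0 <= `|f z| * weight lam z `^ p^-1 by rewrite mulr_ge0 ?powR_ge0.
have [Kz|Kz] := pselect (support_box lam z).
  by rewrite indicE mem_set// mulr1; apply: critical_young => //; rewrite p_gt1.
rewrite /weight (profile_eq0 _ _ _ lam0 Hz Kz) powR0 ?invr_eq0 ?gt_eqF//.
rewrite mulr0 mulr0 powR0 ?gt_eqF// mulr0 addr0 mulr_ge0//.
by rewrite mulr_ge0 ?exprn_ge0// ltW.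
Qed.

End Lp_loc_function.
End critical_estimate.

(** * Lower order terms vanish in the limit *)

Lemma limn_einf_le {R : realType} (u : nat -> \bar R) (a : \bar R) :
  (forall N, (u N <= a)%E) -> (limn_einf u <= a)%E.
Proof.
move=> ua; rewrite limn_einf_lim; apply: lime_le; first exact: is_cvg_einfs.
apply: nearW => N; apply: le_trans (ua N).
by apply: ereal_inf_lbound; exists N => //=; exact: leqnn.
Qed.

Section vanishing.
Context {R : realType} {n : nat} (n_gt0 : (0 < n)%N).
Local Notation TX := (R * 'rV[R]_n)%type.
Local Notation MTX := (measurableTypeR R * 'rV[R]_n)%type.
Local Notation mu := (@leb_tx R n).
Local Notation H := (@closed_half_space R n : set MTX).
Context (p : R) (f : TX -> R) (p_crit : 1 < p <= 1 + 2 / n%:R)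
  (Lpf : Lp_loc_tx (@closed_half_space R n) p f).
Context (lam_ : nat -> R) (lam01 : forall N, 0 < lam_ N <= 1)
  (lam_cvg0 : lam_ @ \oo --> 0).

Let mH := @measurable_half_space R n.
Let lam_gt0 N : 0 < lam_ N. Proof. by case/andP: (lam01 N). Qed.
Let p_gt1 : 1 < p. Proof. by case/andP: p_crit. Qed.
Let p_gt0 : 0 < p. Proof. exact: lt_trans p_gt1. Qed.
Let mf : measurable_fun H (f : MTX -> R). Proof. by case: Lpf. Qed.
Let mfp : measurable_fun H (fun z => `|f z| `^ p : R).
Proof. exact: measurable_norm_powR. Qed.

(** Fatou's lemma: the weight tends pointwise to a positive constant. *)
Lemma integrable_powR_of_weighted (A : R) :
  (forall N, \int[mu]_(z in H) (`|f z| `^ p * weight (lam_ N) z) <= A) ->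
  mu.-integrable H (EFin \o (fun z => `|f z| `^ p)).
Proof.
move=> hA.
pose e : R := time_profile 1 1 2^-1 * flat 1 1.
have e0 : 0 < e.
  rewrite /e /time_profile hornerC mul1r mulr_gt0// flat_gt0E// ?hornerC ?mulr_gt0 ?expR_gt0//.
  by rewrite subr_gt0 expr2 mulr_ilt1// ?invr_ge0// invf_lt1// ltr1n.
have F : (\int[mu]_(z in H) (`|f z| `^ p * e)%:E <= A%:E)%E.
  apply: (@le_trans _ _ (\int[mu]_(z in H) limn_einf
      (fun N => (`|f z| `^ p * weight (lam_ N) z)%:E))%E).
    rewrite le_eqVlt; apply/orP; left; apply/eqP; apply: eq_integral => z _.
    suff c : (fun N => (`|f z| `^ p * weight (lam_ N) z)%:E) @ \oo -->
        (`|f z| `^ p * e)%:E by rewrite (cvg_limn_einf_sup c).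
    apply: cvg_EFin; first by apply: nearW.
    by apply: cvgM; [exact: cvg_cst|exact: cvg_profile].
  apply: le_trans (fatou _ _ _ _) _.
  - exact: mH.
  - move=> N; apply/measurable_EFinP; apply: measurable_funM => //.
    by apply: measurable_funTS; exact: measurable_profile.
  - by move=> N z _; rewrite lee_fin mulr_ge0 ?powR_ge0 ?weight_ge0.
  apply: limn_einf_le => N.
  have i := integrable_powR_weight p_gt1 Lpf (lam_gt0 N).
  by rewrite -[leLHS]fineK ?lee_fin ?hA//; exact: integrable_fin_num.
suff : mu.-integrable H (EFin \o (fun z => e^-1 * (`|f z| `^ p * e))).
  apply: (eq_integrable mH) => z _ /=.
  by rewrite mulrCA mulVf ?mulr1// gt_eqF.
apply: integrable_EFinZl => //; apply/integrableP; split.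
  by apply/measurable_EFinP; apply: measurable_funM.
apply: le_lt_trans (ltry A); apply: le_trans F.
rewrite le_eqVlt; apply/orP; left; apply/eqP; apply: eq_integral => z _ /=.
by rewrite ger0_norm// mulr_ge0 ?powR_ge0// ltW.
Qed.

(** Below the threshold eps lam^n the integral costs at most e/2 by the choice of
eps; above it the integrand is at most g, to which dominated convergence
applies. *)
Lemma lower_order_vanishes (A : R) :
  (forall N, \int[mu]_(z in H) (`|f z| `^ p * weight (lam_ N) z) <= A) ->
  (fun N => lam_ N ^+ 2 *
    \int[mu]_(z in H) (`|f z| * weight (lam_ N) z `^ p^-1)) @ \oo --> 0.
Proof.
move=> /integrable_powR_of_weighted ifp.
apply/cvgr0Pnorm_le => e e0.
(* The box contributes eps * 2^n, hence e/2. *)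
pose eps := e / 2 / 2 ^+ n.
have eps0 : 0 < eps by rewrite !divr_gt0// exprn_gt0.
pose g N (z : MTX) : R := Num.min (lam_ N ^+ 2 * `|f z|) (eps `^ (1 - p) * `|f z| `^ p).
have g_ge0 N z : 0 <= g N z.
  by rewrite /g le_min; apply/andP; split; rewrite mulr_ge0 ?sqr_ge0 ?powR_ge0.
have mg N : measurable_fun H (g N).
  apply: measurable_minr; apply: measurable_funM => //.
  exact: measurableT_comp.
have ig : mu.-integrable H (EFin \o (fun z => eps `^ (1 - p) * `|f z| `^ p)).
  exact: integrable_EFinZl.
have igN N : mu.-integrable H (EFin \o g N).
  apply: (le_integrable mH _ _ ig); first exact/measurable_EFinP.
  move=> z _ /=; rewrite lee_fin (ger0_norm (g_ge0 N z)) ger0_norm ?mulr_ge0 ?powR_ge0//.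
  by rewrite /g ge_min lexx orbT.
have g_cvg : (fun N => \int[mu]_(z in H) g N z) @ \oo --> 0.
  have := @dominated_cvg _ _ _ mu H mH (fun N z => (g N z)%:E) (cst 0%E)
    (EFin \o (fun z => eps `^ (1 - p) * `|f z| `^ p)).
  rewrite integral0 => h; apply: fine_cvg; apply: h => //.
  - by move=> N; exact/measurable_EFinP.
  - move=> z _; apply: cvg_EFin; first by apply: nearW.
    apply: (@squeeze_cvgr _ _ _ _ (cst 0) (fun N => lam_ N ^+ 2 * `|f z|)).
    + by apply: nearW => N; rewrite g_ge0/= /g ge_min lexx.
    + exact: cvg_cst.
    + rewrite -(mul0r `|f z|); apply: cvgM; last exact: cvg_cst.
      rewrite -(mulr0 (0 : R)) (_ : (fun _ => _) = lam_ \* lam_).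
        exact: cvgM.
      by apply/funext => N; rewrite expr2.
  - move=> N z _ /=; rewrite lee_fin ger0_norm//.
    by rewrite /g ge_min lexx orbT.
near=> N.
rewrite ger0_norm; last first.
  rewrite mulr_ge0 ?sqr_ge0// Rintegral_ge0// => z _.
  by rewrite mulr_ge0 ?powR_ge0.
have lam0 := lam_gt0 N.
have iB := integrable_norm_weight p_gt1 Lpf lam0.
have [iK IK] := @integral_support_box _ n _ (eps * lam_ N ^+ (n + 2)) lam0.
have IKe : \int[mu]_(z in H) (eps * lam_ N ^+ (n + 2) *
    \1_(@support_box R n (lam_ N)) z) = e / 2.
  rewrite IK mulrACA divff ?mulr1 ?gt_eqF ?exprn_gt0//.
  by rewrite /eps divfK// gt_eqF// exprn_gt0.
apply: (@le_trans _ _ (e / 2 + \int[mu]_(z in H) g N z)); last first.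
  rewrite [leRHS](splitr e) lerD2l.
  apply: le_trans (ler_norm _) _; near: N.
  by apply: cvgr0_norm_le => //; rewrite divr_gt0.
rewrite -IKe -RintegralZl// -RintegralD//.
apply: le_Rintegral => //; first exact: integrable_EFinZl.
  exact: integrable_EFinD.
move=> z Hz; have w1 : `|f z| * weight (lam_ N) z `^ p^-1 <= `|f z|.
  by rewrite ler_piMr// weight_powR_le1// invr_ge0 ltW.
have [Kz|Kz] := pselect (support_box (lam_ N) z); last first.
  rewrite /weight (profile_eq0 _ _ _ lam0 Hz Kz) powR0 ?invr_eq0 ?gt_eqF//.
  rewrite mulr0 mulr0 addr_ge0// mulr_ge0// mulr_ge0 ?exprn_ge0// ltW//.
rewrite indicE mem_set// mulr1.
have [fl|fl] := leP (eps * lam_ N ^+ n) `|f z|; last first.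
  apply: (@le_trans _ _ (eps * lam_ N ^+ (n + 2))); last by rewrite lerDl.
  by rewrite addnC exprD [leRHS]mulrCA ler_wpM2l ?sqr_ge0// (le_trans w1)// ltW.
apply: (@le_trans _ _ (g N z)); last first.
  by rewrite lerDr mulr_ge0 ?exprn_ge0// ltW.
rewrite /g le_min ler_wpM2l ?sqr_ge0//=.
rewrite (le_trans _ (critical_large n_gt0 p_crit (lam01 N) eps0 fl))//.
by rewrite ler_wpM2l ?sqr_ge0.
Unshelve. all: by end_near. Qed.

End vanishing.

(** * The differential expressions acting on the two unknowns and on the data *)

Section main.
Context {R : realType} {n : nat}.
Implicit Types lam : R.
Local Notation X := 'rV[R]_n.
Local Notation TX := (R * 'rV[R]_n)%type.
Local Notation MTX := (measurableTypeR R * 'rV[R]_n)%type.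
Local Notation mu := (@leb_tx R n).
Local Notation H := (@closed_half_space R n : set MTX).
Let mH := @measurable_half_space R n.

(** The expression - dt Psi - Delta Psi + int_t^oo Delta^2 Psi that multiplies u_t,
divided by lam^2. *)
Definition velocity_symbol lam (z : TX) : R :=
  - (2^-1 * profile_dt 'X 'X^2 1 lam z)
  + profile 1 1 (radial_laplacian (n:=n) (radial_laplacian (n:=n) 1)) lam z
  - profile 'X 'X^2 (radial_laplacian (n:=n) 1) lam z.

(** The expression - dt Psi that multiplies theta, divided by lam^2. *)
Definition temperature_symbol lam (z : TX) : R :=
  - (2^-1 * profile_dt 'X 'X^2 1 lam z).

Lemma temperature_symbol_bound b : b < 1 -> exists2 C : R, 0 <= C &
  forall lam (z : TX), 0 <= z.1 ->
    `|temperature_symbol lam z| <= C * weight lam z `^ b.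
Proof.
move=> b1.
have [C1 C10 h1] := @profile_bound R n ('X)^`() 'X^2 1 b b1.
have [C2 C20 h2] := @profile_bound R n (- 2%:R *: ('X * 'X)) (flat_deriv 'X^2) 1 b b1.
exists (C1 + C2); first exact: addr_ge0.
move=> lam z z0; rewrite /temperature_symbol normrN normrM ger0_norm ?invr_ge0//.
have h : `|profile_dt 'X 'X^2 1 lam z| <= (C1 + C2) * weight lam z `^ b.
  rewrite mulrDl /profile_dt (le_trans (ler_normD _ _))// lerD//; [exact: h1|exact: h2].
by apply: le_trans h; rewrite ler_piMl// invf_le1// ler1n.
Qed.

Lemma velocity_symbol_bound b : b < 1 -> exists2 C : R, 0 <= C &
  forall lam (z : TX), 0 <= z.1 ->
    `|velocity_symbol lam z| <= C * weight lam z `^ b.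
Proof.
move=> b1; have [C1 C10 h1] := temperature_symbol_bound b1.
have [C2 C20 h2] := @profile_bound R n 1 1
  (radial_laplacian (n:=n) (radial_laplacian (n:=n) 1)) b b1.
have [C3 C30 h3] := @profile_bound R n 'X 'X^2 (radial_laplacian (n:=n) 1) b b1.
exists (C1 + C2 + C3); first by rewrite !addr_ge0.
move=> lam z z0; rewrite !mulrDl (le_trans (ler_normB _ _))// lerD//; last exact: h3.
by rewrite (le_trans (ler_normD _ _))// lerD//; [exact: h1|exact: h2].
Qed.

Lemma measurable_temperature_symbol lam :
  measurable_fun [set: MTX] (temperature_symbol lam : MTX -> R).
Proof.
apply: measurable_funN; apply: measurable_funM; first exact: measurable_cst.
by apply: measurable_funD; exact: measurable_profile.
Qed.

Lemma measurable_velocity_symbol lam :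
  measurable_fun [set: MTX] (velocity_symbol lam : MTX -> R).
Proof.
apply: measurable_funB; last exact: measurable_profile.
apply: measurable_funD; last exact: measurable_profile.
exact: measurable_temperature_symbol.
Qed.

(** Only the sum of the data is integrable on the whole space; each datum is
separately integrable against the cutoff because it is locally integrable. *)
Lemma integrable_L1_loc_bump (g : X -> R) (h : X -> R) (r C : R) : 0 < r ->
  L1_loc_x g -> measurable_fun setT h -> (forall x, `|h x| <= C) ->
  (forall x, ~ space_box r x -> h x = 0) ->
  (leb R n).-integrable setT (EFin \o (fun x => g x * h x)).
Proof.
move=> r0 [mg gK] mh hC h0; pose K : set X := space_box r.
have mK : measurable K := measurable_space_box r.
have cK : compact K.
  apply: (@rV_compact R n (fun=> `[(- r : R), r]%classic)) => i.
  exact: segment_compact.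
have igK : (leb R n).-integrable K (EFin \o g).
  apply/integrableP; split; last exact: gK.
  by apply/measurable_EFinP; exact: measurable_funTS.
have C0 : 0 <= C by rewrite (le_trans _ (hC 0)).
have : (leb R n).-integrable K (EFin \o (fun x => g x * h x)).
  apply: (le_integrable mK _ _ (integrable_EFinZl mK C igK)).
    by apply/measurable_EFinP; apply: measurable_funTS; exact: measurable_funM.
  move=> x Kx /=; rewrite lee_fin !normrM mulrC ler_wpM2r//.
  by rewrite (ger0_norm C0).
move=> /(integrable_mkcond _ mK).1; apply: eq_integrable => // x _.
rewrite /patch; case: ifPn => //; rewrite notin_setE => /h0 hx0.
by rewrite /= hx0 mulr0.
Qed.

Lemma cutoff0E lam (x : X) : cutoff lam (0, x) =
  time_profile 'X 'X^2 2^-1 * flat 1 (1 - lam ^+ 2 * sqnorm x) :> R.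
Proof. by rewrite /cutoff /profile /rescaled_time /= mulr0 add0r mul1r. Qed.

Lemma time_profile_half_gt0 : 0 < time_profile 'X 'X^2 2^-1 :> R.
Proof.
rewrite /time_profile hornerX mulr_gt0// ?invr_gt0//.
have s0 : 0 < 1 - 2^-1 ^+ 2 :> R.
  by rewrite subr_gt0 expr2 mulr_ilt1// ?invr_ge0// invf_lt1// ltr1n.
by rewrite flat_gt0E// hornerXn mulr_gt0 ?expR_gt0// exprn_gt0// invr_gt0.
Qed.

Lemma cutoff0_bound lam (x : X) :
  `|cutoff lam (0, x)| <= time_profile 'X 'X^2 2^-1 :> R.
Proof.
rewrite cutoff0E normrM (gtr0_norm time_profile_half_gt0) ler_piMr//.
  exact/ltW/time_profile_half_gt0.
by rewrite ger0_norm ?flat1_ge0 ?flat1_le1.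
Qed.

Lemma measurable_cutoff0 lam : measurable_fun [set: X] (fun x : X => cutoff lam (0, x) : R).
Proof.
have mp : measurable_fun [set: X] (fun x => ((0 : measurableTypeR R), x) : MTX).
  by apply/measurable_fun_pair => //; exact: measurable_cst.
exact: (measurableT_comp (measurable_profile 'X 'X^2 1 lam) mp).
Qed.

Lemma cutoff0_eq0 lam (x : X) : 0 < lam -> ~ space_box lam^-1 x ->
  cutoff lam (0, x) = 0 :> R.
Proof. by move=> lam0 xb; apply: profile_eq0_coord. Qed.

(** Dominated convergence; the limit constant is the value of the profile at the
origin. *)
Lemma cvg_data (g : X -> R) (lam_ : nat -> R) : lam_ @ \oo --> 0 ->
  (leb R n).-integrable setT (EFin \o g) ->
  (fun N => \int[leb R n]_x (g x * cutoff (lam_ N) (0, x))) @ \oo -->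
  time_profile 'X 'X^2 2^-1 * flat 1 1 * \int[leb R n]_x g x.
Proof.
move=> lam0 ig; have mg := measurable_int _ ig.
set k := time_profile 'X 'X^2 2^-1.
have k0 : 0 < k := time_profile_half_gt0.
rewrite -RintegralZl//.
have mgr : measurable_fun setT g by apply/measurable_EFinP.
have ikg : (leb R n).-integrable setT (EFin \o (fun x => k * `|g x|)).
  by apply: integrable_EFinZl => //; exact: (integrable_norm ig).
have ikfg : (leb R n).-integrable setT (EFin \o (fun x => k * flat 1 1 * g x)).
  exact: integrable_EFinZl.
have := @dominated_cvg _ _ _ (leb R n) setT measurableT
  (fun N x => (g x * cutoff (lam_ N) (0, x))%:E)
  (fun x => (k * flat 1 1 * g x)%:E) (EFin \o (fun x => k * `|g x|)).
move=> h; apply: fine_cvg; rewrite /Rintegral fineK; last exact: integrable_fin_num.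
apply: h => //.
- move=> N; apply/measurable_EFinP; apply: measurable_funM => //.
  exact: measurable_cutoff0.
- move=> x _; apply: cvg_EFin; first by apply: nearW.
  rewrite mulrC; apply: cvgM; first exact: cvg_cst.
  exact: (@cvg_profile R n 'X 'X^2 1 lam_ (0, x)).
- move=> N x _ /=; rewrite lee_fin normrM mulrC ler_wpM2r//.
  exact: cutoff0_bound.
Qed.

End main.

(** * Testing the system with the cutoff *)

Section energy.
Context {R : realType} {n : nat}.
Implicit Types lam : R.
Local Notation X := 'rV[R]_n.
Local Notation TX := (R * 'rV[R]_n)%type.
Local Notation MTX := (measurableTypeR R * 'rV[R]_n)%type.
Local Notation mu := (@leb_tx R n).
Local Notation H := (@closed_half_space R n : set MTX).
Let mH := @measurable_half_space R n.

Lemma integrable_mul_symbol (p : R) (f : TX -> R) lam (S : TX -> R) (C b : R) :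
  0 <= b -> 0 <= C -> 1 < p -> Lp_loc_tx (@closed_half_space R n) p f -> 0 < lam ->
  measurable_fun [set: MTX] (S : MTX -> R) ->
  (forall z : TX, 0 <= z.1 -> `|S z| <= C * weight lam z `^ b) ->
  (forall z : TX, 0 <= z.1 -> ~ support_box lam z -> S z = 0) ->
  mu.-integrable H (EFin \o (fun z => f z * S z)).
Proof.
move=> b0 C0 p1 Lf lam0 mS bS S0.
have [] // := @integrable_cutoff_mul R n p f p1 Lf lam S C lam0 mS _ S0.
by move=> z z0; rewrite (le_trans (bS z z0))// ler_piMr// weight_powR_le1.
Qed.

Lemma temperature_symbol_eq0 lam (z : TX) : 0 < lam -> 0 <= z.1 ->
  ~ support_box lam z -> temperature_symbol lam z = 0.
Proof.
move=> lam0 z0 zK.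
by rewrite /temperature_symbol /profile_dt !profile_eq0// addr0 mulr0 oppr0.
Qed.

Lemma velocity_symbol_eq0 lam (z : TX) : 0 < lam -> 0 <= z.1 ->
  ~ support_box lam z -> velocity_symbol lam z = 0.
Proof.
move=> lam0 z0 zK; rewrite /velocity_symbol.
by rewrite -/(temperature_symbol lam z) temperature_symbol_eq0// !profile_eq0// addr0 subr0.
Qed.

(** When the coefficient c vanishes nothing is known about g, and the term is
identically 0. *)
Lemma integrable_powR_cutoff (c q : R) (g : TX -> R) lam : 0 <= c -> 1 < q ->
  (0 < c -> Lp_loc_tx (@closed_half_space R n) q g) -> 0 < lam ->
  mu.-integrable H (EFin \o (fun z => c * `|g z| `^ q * cutoff lam z)).
Proof.
rewrite le_eqVlt => /predU1P[<- _ _ _|c0 q1 /(_ c0) Lg lam0].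
  rewrite (_ : _ \o _ = cst 0%E); first exact: integrable0.
  by apply/funext => z /=; rewrite !mul0r.
have [C C0 bC] := @profile_bound R n 'X 'X^2 1 0 ltr01.
have [] := @integrable_cutoff_mul R n q g q1 Lg lam (cutoff lam) C lam0.
- exact: measurable_profile.
- by move=> z z0; rewrite (le_trans (bC lam z z0))// powRr0 mulr1.
- by move=> z z0 zK; exact: profile_eq0.
move=> _ /(integrable_EFinZl mH c); apply: eq_integrable => // z _ /=.
by rewrite mulrA.
Qed.

(** The Laplacian part is added back because in the first equation it acts on theta
and not on u_t. *)
Lemma velocity_symbolE lam (z : TX) : 0 < lam -> 0 <= z.1 ->
  - dt (cutoff lam) z
  + \int[lebesgue_measure]_(tau in `[z.1, +oo[)
      bilaplacian (cutoff lam) (tau, z.2) =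
  lam ^+ 2 * (velocity_symbol lam z
              + profile 'X 'X^2 (radial_laplacian (n:=n) 1) lam z).
Proof.
move=> lam0 z0; rewrite /velocity_symbol subrK mulrDr; congr (_ + _).
  by rewrite /cutoff dt_profile mulrN mulrA.
rewrite /cutoff bilaplacian_profile.
rewrite [X in Rintegral _ _ X](_ : _ = fun tau : R =>
  profile 'X 'X^2 (lam ^+ 4 *: radial_laplacian (n:=n) (radial_laplacian (n:=n) 1))
    lam (tau, z.2)); last by apply/funext => tau; rewrite -profileZ.
rewrite tail_integral_profile// -profileZ -surjective_pairing mulrA.
by congr (_ * _); field; rewrite gt_eqF.
Qed.

(** The sum of the two equations.  The terms theta Delta Psi have opposite signs
and cancel; the term u_t Delta Psi of the second equation completes the
expression acting on u_t. *)
Lemma weak_identity (p q : R) (f1 f2 v theta : TX -> R) (u1 theta0 : X -> R) lam :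
  0 < lam -> 1 < p -> 1 < q ->
  Lp_loc_tx (@closed_half_space R n) p v ->
  Lp_loc_tx (@closed_half_space R n) q theta ->
  L1_loc_x u1 -> L1_loc_x theta0 ->
  mu.-integrable H (EFin \o (fun z => f1 z * cutoff lam z)) ->
  mu.-integrable H (EFin \o (fun z => f2 z * cutoff lam z)) ->
  \int[mu]_(z in H) (f1 z * cutoff lam z)
  + \int[leb R n]_x (u1 x * cutoff lam (0, x)) =
  \int[mu]_(z in H) (v z * (- dt (cutoff lam) z
      + \int[lebesgue_measure]_(tau in `[z.1, +oo[)
          bilaplacian (cutoff lam) (tau, z.2)))
  + \int[mu]_(z in H) (theta z * laplacian (cutoff lam) z) ->
  \int[mu]_(z in H) (f2 z * cutoff lam z)
  + \int[leb R n]_x (theta0 x * cutoff lam (0, x)) =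
  \int[mu]_(z in H) (theta z * (- dt (cutoff lam) z - laplacian (cutoff lam) z))
  - \int[mu]_(z in H) (v z * laplacian (cutoff lam) z) ->
  \int[mu]_(z in H) ((f1 z + f2 z) * cutoff lam z)
  + \int[leb R n]_x ((u1 x + theta0 x) * cutoff lam (0, x)) =
  lam ^+ 2 * (\int[mu]_(z in H) (v z * velocity_symbol lam z)
              + \int[mu]_(z in H) (theta z * temperature_symbol lam z)).
Proof.
move=> lam0 p1 q1 Lv Lt L1 L0 if1 if2.
pose S : TX -> R := profile 'X 'X^2 (radial_laplacian (n:=n) 1) lam.
have mS : measurable_fun [set: MTX] (S : MTX -> R) by exact: measurable_profile.
have [Cv Cv0 bv] := @velocity_symbol_bound R n 0 ltr01.
have [Ct Ct0 bt] := @temperature_symbol_bound R n 0 ltr01.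
have [Cs Cs0 bs] := @profile_bound R n 'X 'X^2 (radial_laplacian (n:=n) 1) 0 ltr01.
have S0 (z : TX) : 0 <= z.1 -> ~ support_box lam z -> S z = 0.
  by move=> z0 zK; exact: profile_eq0.
have ivS := integrable_mul_symbol (lexx 0) Cs0 p1 Lv lam0 mS (bs lam) S0.
have itS := integrable_mul_symbol (lexx 0) Cs0 q1 Lt lam0 mS (bs lam) S0.
have ivV := integrable_mul_symbol (lexx 0) Cv0 p1 Lv lam0 (measurable_velocity_symbol lam)
  (bv lam) (fun z => velocity_symbol_eq0 lam0).
have itT := integrable_mul_symbol (lexx 0) Ct0 q1 Lt lam0 (measurable_temperature_symbol lam)
  (bt lam) (fun z => temperature_symbol_eq0 lam0).
have lapE : laplacian (cutoff lam) = fun z => lam ^+ 2 * S z by exact: laplacian_profile.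
have dtE (z : TX) : - dt (cutoff lam) z = lam ^+ 2 * temperature_symbol lam z.
  by rewrite /cutoff dt_profile /temperature_symbol mulrN mulrA.
have -> : \int[mu]_(z in H) (v z * (- dt (cutoff lam) z
      + \int[lebesgue_measure]_(tau in `[z.1, +oo[)
          bilaplacian (cutoff lam) (tau, z.2))) =
    lam ^+ 2 * (\int[mu]_(z in H) (v z * velocity_symbol lam z)
                + \int[mu]_(z in H) (v z * S z)).
  rewrite -RintegralD// -RintegralZl//; last exact: integrable_EFinD.
  apply: eq_Rintegral => z; rewrite inE => z0.
  by rewrite velocity_symbolE// -mulrDr mulrCA.
have -> : \int[mu]_(z in H) (theta z * laplacian (cutoff lam) z) =
    lam ^+ 2 * \int[mu]_(z in H) (theta z * S z).
  by rewrite -RintegralZl//; apply: eq_Rintegral => z _; rewrite lapE mulrCA.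
have -> : \int[mu]_(z in H) (v z * laplacian (cutoff lam) z) =
    lam ^+ 2 * \int[mu]_(z in H) (v z * S z).
  by rewrite -RintegralZl//; apply: eq_Rintegral => z _; rewrite lapE mulrCA.
have -> : \int[mu]_(z in H) (theta z * (- dt (cutoff lam) z - laplacian (cutoff lam) z)) =
    lam ^+ 2 * (\int[mu]_(z in H) (theta z * temperature_symbol lam z)
                - \int[mu]_(z in H) (theta z * S z)).
  rewrite -RintegralB// -RintegralZl//; last first.
    rewrite (_ : _ \o _ = EFin \o (fun z => theta z * temperature_symbol lam z
      + (-1) * (theta z * S z))).
      by apply: integrable_EFinD => //; exact: integrable_EFinZl.
    by apply/funext => z /=; rewrite mulN1r.
  apply: eq_Rintegral => z _.
  by rewrite dtE lapE -mulrBr -mulrBr mulrCA.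
move=> e1 e2.
have li : 0 < lam^-1 by rewrite invr_gt0.
have id1 := integrable_L1_loc_bump li L1 (measurable_cutoff0 lam)
  (cutoff0_bound lam) (fun x => cutoff0_eq0 lam0).
have id0 := integrable_L1_loc_bump li L0 (measurable_cutoff0 lam)
  (cutoff0_bound lam) (fun x => cutoff0_eq0 lam0).
have -> : \int[mu]_(z in H) ((f1 z + f2 z) * cutoff lam z) =
    \int[mu]_(z in H) (f1 z * cutoff lam z) + \int[mu]_(z in H) (f2 z * cutoff lam z).
  by rewrite -RintegralD//; apply: eq_Rintegral => z _; rewrite mulrDl.
have -> : \int[leb R n]_x ((u1 x + theta0 x) * cutoff lam (0, x)) =
    \int[leb R n]_x (u1 x * cutoff lam (0, x))
    + \int[leb R n]_x (theta0 x * cutoff lam (0, x)).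
  by rewrite -RintegralD//; apply: eq_Rintegral => x _; rewrite mulrDl.
by rewrite addrACA e1 e2; ring.
Qed.

Lemma symbol_integral_le (p : R) (f : TX -> R) lam (S : TX -> R) (C : R) :
  1 < p -> Lp_loc_tx (@closed_half_space R n) p f -> 0 < lam ->
  mu.-integrable H (EFin \o (fun z => f z * S z)) ->
  (forall z : TX, 0 <= z.1 -> `|S z| <= C * weight lam z `^ p^-1) ->
  \int[mu]_(z in H) (f z * S z) <=
  C * \int[mu]_(z in H) (`|f z| * weight lam z `^ p^-1).
Proof.
move=> p1 Lf lam0 iS bS; have iW := integrable_norm_weight p1 Lf lam0.
rewrite -RintegralZl//; apply: le_Rintegral => //.
  exact: integrable_EFinZl.
move=> z z0; rewrite (le_trans (ler_norm _))// normrM mulrCA.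
by rewrite ler_wpM2l// bS.
Qed.

End energy.

(** Supplies the level eps at which the right-hand side is absorbed. *)
Lemma small_powR {R : realType} (p C c : R) : 1 < p -> 0 <= C -> 0 < c ->
  exists2 eps, 0 < eps & C * eps `^ (1 - p) <= c.
Proof.
move=> p1 C0 c0; pose K := C / c + 1.
have K0 : 0 < K by rewrite ltr_wpDl ?divr_ge0// ltW.
exists (K `^ (p - 1)^-1); first exact: powR_gt0.
rewrite -powRrM -(opprB p 1) mulrN mulVf ?subr_eq0 ?gt_eqF//.
rewrite powR_inv1 ?(ltW K0)// ler_pdivrMr// mulrDr mulr1 mulrCA divff ?mulr1 ?gt_eqF//.
by rewrite lerDl ltW.
Qed.

(** * Conclusion *)

(** Both terms on the right are first absorbed in half of the left, which bounds the
weighted integrals along the sequence lam = 1/(N+1); then they tend to 0, so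
that the limit of D cannot be positive. *)
Lemma energy_contradiction {R : realType} {n : nat} (p q c d C1 C2 Dinf : R)
    (v theta : R * 'rV[R]_n -> R) (D : R -> R) : (0 < n)%N ->
  1 < p <= 1 + 2 / n%:R -> 1 < q <= 1 + 2 / n%:R ->
  Lp_loc_tx (@closed_half_space R n) p v ->
  Lp_loc_tx (@closed_half_space R n) q theta ->
  0 < c -> 0 < d -> 0 <= C1 -> 0 <= C2 ->
  (forall lam, 0 < lam <= 1 ->
    (c * \int[@leb_tx R n]_(z in closed_half_space) (`|v z| `^ p * weight lam z)
     + d * \int[@leb_tx R n]_(z in closed_half_space) (`|theta z| `^ q * weight lam z))
      / 2 + D lam <=
    lam ^+ 2 *
    (C1 * \int[@leb_tx R n]_(z in closed_half_space) (`|v z| * weight lam z `^ p^-1)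
     + C2 * \int[@leb_tx R n]_(z in closed_half_space)
         (`|theta z| * weight lam z `^ q^-1))) ->
  (fun N => D (N.+1%:R^-1)) @ \oo --> Dinf -> 0 < Dinf -> False.
Proof.
move=> n_gt0 pc qc Lv Lt c0 d0 C10 C20 energy Dcvg D0.
have /andP[p1 pn] := pc; have /andP[q1 qn] := qc.
have D2 : Dinf / 2 < Dinf by rewrite ltr_pdivrMr// ltr_pMr// ltr1n.
(* Shift the sequence so that D stays above Dinf / 2, in particular positive. *)
have [M _ hM] := cvgr_gt _ Dcvg _ D2.
pose lam_ N : R := (N + M).+1%:R^-1.
have lam01 N : 0 < lam_ N <= 1.
  by rewrite invr_gt0 ltr0n/= invf_le1 ?ltr0n// ler1n.
have lam_cvg : lam_ @ \oo --> 0.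
  have := @cvg_harmonic R; rewrite -(cvg_shiftn M); exact.
have DN N : Dinf / 2 <= D (lam_ N) by apply/ltW/hM => /=; exact: leq_addl.
pose A1 lam := \int[@leb_tx R n]_(z in closed_half_space) (`|v z| `^ p * weight lam z).
pose A2 lam := \int[@leb_tx R n]_(z in closed_half_space)
  (`|theta z| `^ q * weight lam z).
pose B1 lam := \int[@leb_tx R n]_(z in closed_half_space)
  (`|v z| * weight lam z `^ p^-1).
pose B2 lam := \int[@leb_tx R n]_(z in closed_half_space)
  (`|theta z| * weight lam z `^ q^-1).
have A10 lam : 0 <= A1 lam.
  by apply: Rintegral_ge0 => z _; rewrite mulr_ge0 ?powR_ge0 ?weight_ge0.
have A20 lam : 0 <= A2 lam.
  by apply: Rintegral_ge0 => z _; rewrite mulr_ge0 ?powR_ge0 ?weight_ge0.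
(* The left-hand side carries c/2 and d/2; the levels are chosen to use up half of
each. *)
have [e1 e10 he1] := small_powR p1 C10 (divr_gt0 c0 (ltr0n R 4)).
have [e2 e20 he2] := small_powR q1 C20 (divr_gt0 d0 (ltr0n R 4)).
pose K := C1 * (e1 * 2 ^+ n) + C2 * (e2 * 2 ^+ n).
have AK N : c * A1 (lam_ N) + d * A2 (lam_ N) <= 4 * K.
  have := energy _ (lam01 N).
  have := lower_order_le n_gt0 p1 Lv pn (lam01 N) e10.
  have := lower_order_le n_gt0 q1 Lt qn (lam01 N) e20.
  rewrite -/(A1 _) -/(A2 _) -/(B1 _) -/(B2 _) => h2 h1 h.
  have {}h1 := ler_wpM2l C10 h1; have {}h2 := ler_wpM2l C20 h2.
  have g1 := ler_wpM2r (A10 (lam_ N)) he1; have g2 := ler_wpM2r (A20 (lam_ N)) he2.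
  have := DN N; rewrite /K; move: h h1 h2 g1 g2; rewrite !mulrDr !mulrA.
  set x1 := C1 * e1 `^ (1 - p) * A1 _; set x2 := C2 * e2 `^ (1 - q) * A2 _.
  rewrite !(mulrC (lam_ N ^+ 2)) !(mulrAC _ (lam_ N ^+ 2)).
  lra.
have cA1 N : 0 <= c * A1 (lam_ N) by apply: mulr_ge0; [exact: ltW|exact: A10].
have dA2 N : 0 <= d * A2 (lam_ N) by apply: mulr_ge0; [exact: ltW|exact: A20].
have b1 N : A1 (lam_ N) <= 4 * K / c.
  by have := AK N; have := dA2 N; rewrite ler_pdivlMr//; lra.
have b2 N : A2 (lam_ N) <= 4 * K / d.
  by have := AK N; have := cA1 N; rewrite ler_pdivlMr//; lra.
have v1 := lower_order_vanishes n_gt0 pc Lv lam01 lam_cvg b1.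
have v2 := lower_order_vanishes n_gt0 qc Lt lam01 lam_cvg b2.
have c12 : (fun N => C1 * (lam_ N ^+ 2 * B1 (lam_ N))
    + C2 * (lam_ N ^+ 2 * B2 (lam_ N))) @ \oo --> C1 * 0 + C2 * 0.
  exact: (cvgD (cvgM (cvg_cst C1) v1) (cvgM (cvg_cst C2) v2)).
suff : Dinf / 2 <= C1 * 0 + C2 * 0.
  by rewrite !mulr0 addr0 leNgt divr_gt0.
rewrite -(cvg_lim _ c12)//; apply: limr_ge; first by apply/cvg_ex; eexists; exact: c12.
apply: nearW => N; rewrite (le_trans (DN N))//.
have := energy _ (lam01 N); rewrite -/(A1 _) -/(A2 _) -/(B1 _) -/(B2 _).
have := addr_ge0 (cA1 N) (dA2 N).
rewrite (mulrCA C1) (mulrCA C2) -mulrDr => h1 h2.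
by apply: le_trans h2; rewrite lerDr divr_ge0.
Qed.

Theorem theorem2p2 (R : realType) (n : nat) (hn : (1 <= n)%N)
  (p c1 c2 c3 c4 : 'I_2 -> R) (u0 u1 theta0 : 'rV[R]_n -> R)
  (hp : forall j, 1 < p j)
  (hc : forall j, [/\ 0 <= c1 j, 0 <= c2 j, 0 <= c3 j & 0 <= c4 j])
  (hc1 : c1 0 + c1 1 = 0)
  (hc3 : 0 < c3 0 + c3 1)
  (hc4 : 0 < c4 0 + c4 1)
  (hcrit : forall j, 0 < c3 j \/ 0 < c4 j -> 1 < p j <= 1 + 2 / n%:R)
  (hu0 : u0 = cst 0)
  (hdata : (leb R n).-integrable setT (fun x => (u1 x + theta0 x)%:E))
  (hpos : 0 < \int[leb R n]_x (u1 x + theta0 x)) :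
  ~ exists u theta : R * 'rV[R]_n -> R,
      global_weak_solution c1 c2 c3 c4 p u0 u1 theta0 u theta.
Proof.
move=> [u [theta [[_ Lu1 Ltheta0] [v [w [_ Lw Lv Lt weak]]]]]].
have mH := @measurable_half_space R n.
have sum2 (F : 'I_2 -> R) : \sum_(i < 2) F i = F 0 + F 1.
  by rewrite big_ord_recl big_ord1; congr (_ + F _); exact: val_inj.
have c10 i : c1 i = 0.
  have c1_ge0 j : 0 <= c1 j by case: (hc j).
  apply/eqP; rewrite eq_le c1_ge0 andbT -hc1 -sum2 (bigD1 i)//= lerDl.
  exact: sumr_ge0.
have pick_pos (a : 'I_2 -> R) : 0 < a 0 + a 1 -> exists j, 0 < a j.
  move=> a01; have [a0|a0] := ltP 0 (a 0); first by exists 0.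
  by exists 1; rewrite (lt_le_trans a01)// gerDr.
(* The indices j and k need not agree: u_t and theta may be controlled by different
nonlinearities, with different exponents. *)
have [j c3j] := pick_pos _ hc3; have [k c4k] := pick_pos _ hc4.
have pj := hcrit j (or_introl c3j); have pk := hcrit k (or_intror c4k).
set f := nonlinearity c1 c2 c3 c4 p u w v theta in weak.
have fE i z : f i z = c2 i * `|w z| `^ p i + c3 i * `|v z| `^ p i
    + c4 i * `|theta z| `^ p i.
  by rewrite /f /nonlinearity c10 mul0r add0r.
have f_ge z : c3 j * `|v z| `^ p j + c4 k * `|theta z| `^ p k <= f 0 z + f 1 z.
  rewrite -(sum2 (fun i => f i z)) (eq_bigr _ (fun i _ => fE i z)).
  rewrite !big_split/= lerD//.
    rewrite ler_wpDl ?sumr_ge0// => [i _|].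
      by rewrite mulr_ge0 ?powR_ge0//; case: (hc i).
    rewrite (bigD1 j)//= lerDl sumr_ge0// => i _.
    by rewrite mulr_ge0 ?powR_ge0//; case: (hc i).
  rewrite (bigD1 k)//= lerDl sumr_ge0// => i _.
  by rewrite mulr_ge0 ?powR_ge0//; case: (hc i).
have if_ i lam : 0 < lam ->
    (@leb_tx R n).-integrable closed_half_space (EFin \o (fun z => f i z * cutoff lam z)).
  move=> lam0; have [_ c2i c3i c4i] := hc i.
  rewrite (_ : _ \o _ = EFin \o (fun z => c2 i * `|w z| `^ p i * cutoff lam z
      + c3 i * `|v z| `^ p i * cutoff lam z
      + c4 i * `|theta z| `^ p i * cutoff lam z)); last first.
    by apply/funext => z /=; rewrite fE !mulrDl.
  apply: integrable_EFinD => //; first apply: integrable_EFinD => //.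
  - by apply: integrable_powR_cutoff => // /Lw[].
  - exact: integrable_powR_cutoff (Lv i) _.
  - exact: integrable_powR_cutoff (Lt i) _.
have pjV : (p j)^-1 < 1 by rewrite invf_lt1// (lt_trans _ (hp j)).
have pkV : (p k)^-1 < 1 by rewrite invf_lt1// (lt_trans _ (hp k)).
have [C1 C10 bv] := @velocity_symbol_bound R n _ pjV.
have [C2 C20 bt] := @temperature_symbol_bound R n _ pkV.
have D_cvg := @cvg_data R n _ _ (@cvg_harmonic R) hdata.
pose D lam := \int[leb R n]_x ((u1 x + theta0 x) * cutoff lam (0, x)).
apply: (@energy_contradiction _ _ _ _ _ _ _ _ _ _ _ D hn pj pk (Lv j c3j) (Lt k c4k) c3j c4k C10 C20 _ D_cvg).
  move=> lam /andP[lam0 lam1].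
  have [] := weak _ _ (test_function_profile 'X 'X^2 1 lam0) (test_function_profile 'X 'X^2 1 lam0).
  rewrite -/(cutoff lam) => e1 e2.
  have {}e1 : \int[@leb_tx R n]_(z in closed_half_space) (f 0 z * cutoff lam z)
    + \int[leb R n]_x (u1 x * cutoff lam (0, x)) =
    \int[@leb_tx R n]_(z in closed_half_space) (v z * (- dt (cutoff lam) z
      + \int[lebesgue_measure]_(tau in `[z.1, +oo[)
          bilaplacian (cutoff lam) (tau, z.2)))
    + \int[@leb_tx R n]_(z in closed_half_space) (theta z * laplacian (cutoff lam) z).
    rewrite -e1; congr (_ + _); apply: eq_Rintegral => x _.
    by rewrite hu0 /= oppr0 mul0r add0r.
  have := weak_identity lam0 (hp j) (hp k) (Lv j c3j) (Lt k c4k) Lu1 Ltheta0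
    (if_ 0 lam lam0) (if_ 1 lam lam0) e1 e2.
  move=> E.
  have pj0 : 0 <= (p j)^-1 by rewrite invr_ge0 ltW// (lt_trans _ (hp j)).
  have pk0 : 0 <= (p k)^-1 by rewrite invr_ge0 ltW// (lt_trans _ (hp k)).
  have iV := integrable_mul_symbol pj0 C10 (hp j) (Lv j c3j) lam0
    (measurable_velocity_symbol lam) (bv lam) (fun z => velocity_symbol_eq0 lam0).
  have iT := integrable_mul_symbol pk0 C20 (hp k) (Lt k c4k) lam0
    (measurable_temperature_symbol lam) (bt lam)
    (fun z => temperature_symbol_eq0 lam0).
  have leV := symbol_integral_le (hp j) (Lv j c3j) lam0 iV (bv lam).
  have leT := symbol_integral_le (hp k) (Lt k c4k) lam0 iT (bt lam).
  apply: (@le_trans _ _ (lam ^+ 2 *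
      (\int[@leb_tx R n]_(z in closed_half_space) (v z * velocity_symbol lam z)
       + \int[@leb_tx R n]_(z in closed_half_space)
           (theta z * temperature_symbol lam z)))); last first.
    by apply: ler_wpM2l; [exact: sqr_ge0|exact: lerD].
  rewrite -E /D lerD2r.
  have iv := integrable_powR_weight (hp j) (Lv j c3j) lam0.
  have it := integrable_powR_weight (hp k) (Lt k c4k) lam0.
  have ivc := integrable_EFinZl mH (c3 j) iv.
  have itc := integrable_EFinZl mH (c4 k) it.
  rewrite -!RintegralZl// -RintegralD// mulrC -RintegralZl//; last first.
    exact: integrable_EFinD.
  apply: le_Rintegral => //.
  - by apply: integrable_EFinZl => //; exact: integrable_EFinD.
  - rewrite (_ : _ \o _ = EFin \o (fun z => f 0 z * cutoff lam z + f 1 z * cutoff lam z)).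
      by apply: integrable_EFinD => //; exact: if_.
    by apply/funext => z /=; rewrite mulrDl.
  - move=> z z0; have := weight_le_cutoff lam z0; have := cutoff_ge0 lam z0.
    move: (weight lam z) (cutoff lam z) => W U U0 WU.
    rewrite !mulrA -mulrDl [leLHS]mulrC ler_pdivrMr//.
    have := f_ge z; set F := f 0 z + f 1 z; set L := _ + _ => LF.
    have L0 : 0 <= L.
      rewrite /L addr_ge0// mulr_ge0 ?powR_ge0//; exact: ltW.
    rewrite (le_trans (ler_wpM2l L0 WU))// -(mulrA F) (mulrC U).
    by rewrite ler_wpM2r// mulr_ge0.
by rewrite mulr_gt0// mulr_gt0 ?time_profile_half_gt0// flat_gt0E// hornerC mul1r expR_gt0.
Qed.
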